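(* Under all the assumptions listed in the context, the functional $\overline{\mathrm{MISE}}$ can be represented as $$\overline{\mathrm{MISE}}[p,\hat p,\mathbf{N},\mathbf{h}]=\overline{\mathrm{AMISE}}[p,\hat p,\mathbf{N},\mathbf{h}]+\mathcal{E}(\mathbf{N},\mathbf{h}),$$ where the leading term is $$\overline{\mathrm{AMISE}}[p,\hat p,\mathbf{N},\mathbf{h}]=\Big(\int_{\mathbb{R}}B(x)\,dx\Big)^2\int_{\mathbb{R}}\big(c\,p^*(x)\big)^2dx+\int_{\mathbb{R}}B(x)^2dx+\int_{\mathbb{R}}V(x)\,dx\int_{\mathbb{R}}K^2(t)\,dt-2\iint_{\mathbb{R}^2}B(y)B(x)\,c\,p^*(x)\,dx\,dy,$$ $$B(x)=\frac{c\,k_2}{2}\sum_{m=1}^{M}h_m^2\,p_m''(x)\prod_{k\ne m}p_k(x),\qquad V(x)=c^2\sum_{m=1}^{M}\frac{p_m(x)}{N_mh_m}\prod_{k\neq m}p_k(x)^2,$$ and the error term satisfies $$\mathcal{E}(\mathbf{N},\mathbf{h})=o\Big(\|\mathbf{h}\|^4+\frac{1}{\|\mathbf{N}\|\,\|\mathbf{h}\|}\Big)$$ as $n\to\infty$ (so that $\mathbf{h}\to0$, $\mathbf{N}\to\infty$ and $(\|\mathbf{N}\|\|\mathbf{h}\|)^{-1}\to0$).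
   Context: Fix an integer $M\ge1$ and probability densities $p_1,\dots,p_M$ on $\mathbb{R}$; put $p^*(x)=\prod_{m=1}^Mp_m(x)$, $\lambda=\int_{\mathbb{R}}p^*(x)\,dx$ (assumed $>0$), $c=\lambda^{-1}$ and $p=c\,p^*$. For each $m$ let $X^m_1,\dots,X^m_{N_m}$ be i.i.d. with density $p_m$, the samples for different $m$ being independent, and let $$\hat p_m(x)=\frac1{N_mh_m}\sum_{i=1}^{N_m}K\Big(\frac{x-X_i^m}{h_m}\Big),\qquad \hat p^*(x)=\prod_{m=1}^M\hat p_m(x),\qquad\hat\lambda=\int_{\mathbb{R}}\hat p^*(x)\,dx,\qquad \hat p=\hat\lambda^{-1}\hat p^*,$$ with kernel $K$ and bandwidths $h_m>0$. ($\hat\lambda>0$ is assumed; on an event where $\hat\lambda=0$ the random variable inside the expectation below is read as $0$.) Write $\mathbf{N}=(N_1,\dots,N_M)$, $\mathbf{h}=(h_1,\dots,h_M)$; $\|\cdot\|$ is a fixed norm on $\mathbb{R}^M$. Define $$\overline{\mathrm{MISE}}[p,\hat p,\mathbf{N},\mathbf{h}]=\mathbb{E}\left[\Big(\frac{\hat\lambda}{\lambda}\Big)^2\int_{\mathbb{R}}(\hat p(x)-p(x))^2dx\right].$$ Assumptions: - Kernel: $0\le K\le C$ for some constant $C$, $\int K=1$, $\int tK(t)\,dt=0$, $\int K^2<\infty$, and $k_s:=\int_{\mathbb{R}}|t|^sK(t)\,dt<\infty$ for $s\in\{0,1,2,3\}$. - Densities: for each $m$, $p_m\in C^3(\mathbb{R})$,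 and $p_m^{(s)}$ is bounded on $\mathbb{R}$ and integrable on $\mathbb{R}$ for each $s\in\{0,1,2,3\}$. - Scaling: $\mathbf{N}=\mathbf{N}(n)\in\mathbb{N}^M$ and $\mathbf{h}=\mathbf{h}(n)\in(0,\infty)^M$ are functions of $n\in\mathbb{N}$ such that for all $i$: $D_1\le N_i(n)/n\le D_2$ for some $0<D_1<D_2$; $A_1N_i(n)^{-\alpha_0}\le h_i(n)\le A_2N_i(n)^{-\alpha_0}$ for some $A_1,A_2>0$ and some $\alpha_0\in(0,1)$; and $\lim_{n\to\infty}h_i(n)N_i(n)=\infty$. *)

(* Defs.v *)
From HB Require Import structures.
From mathcomp Require Import all_boot all_order all_algebra finmap.
From mathcomp Require Import all_classical all_reals all_analysis.

Set Implicit Arguments.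
Unset Strict Implicit.
Unset Printing Implicit Defensive.

Import Order.TTheory GRing.Theory Num.Theory.
Import numFieldNormedType.Exports.

Local Open Scope classical_set_scope.
Local Open Scope ring_scope.

Section Independence.
Context d (T : measurableType d) (R : realType) (P : probability T R).

Definition mutually_independent (I : choiceType) (D : set I)
    (X : I -> {RV P >-> R}) : Prop :=
  forall (J : {fset I}) (A : I -> set R),
    [set` J] `<=` D -> (forall i, i \in J -> measurable (A i)) ->
    P (\bigcap_(i in [set` J]) X i @^-1` A i)
      = (\prod_(i <- J) P (X i @^-1` A i))%E.

Definition has_density (X : {RV P >-> R}) (f : R -> R) : Prop :=
  forall A : set R, measurable A ->
    distribution P X A = (\int[lebesgue_measure]_(x in A) (f x)%:E)%E.

(* The sample consists of the X m i with i < N m; the other X m i are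
   unconstrained. *)
Definition sample M (p : 'I_M -> R -> R) (N : 'I_M -> nat)
    (X : 'I_M -> nat -> {RV P >-> R}) : Prop :=
  (forall m i, (i < N m)%N -> has_density (X m i) (p m)) /\
  mutually_independent [set k : 'I_M * nat | (k.2 < N k.1)%N]
    (fun k => X k.1 k.2).

End Independence.

Section Densities.
Context {R : realType}.
Local Notation mu := (@lebesgue_measure R).

Definition is_pdf (f : R -> R) : Prop :=
  [/\ measurable_fun setT f, forall x, 0 <= f x &
      (\int[mu]_x (f x)%:E)%E = 1%E].

Definition Ck (k : nat) (f : R -> R) : Prop :=
  (forall s, (s < k)%N -> forall x, derivable (derive1n s f) x 1) /\
  continuous (derive1n k f).

Definition smooth_density (f : R -> R) : Prop :=
  Ck 3 f /\
  forall s, (s <= 3)%N ->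
    (exists b, forall x, `|derive1n s f x| <= b) /\
    mu.-integrable setT (EFin \o derive1n s f).

Definition abs_moment (K : R -> R) (s : nat) : R :=
  \int[mu]_t (`|t| ^+ s * K t).

Record kde_kernel (K : R -> R) : Prop := KdeKernel {
  kernel_measurable : measurable_fun setT K;
  kernel_bounded : exists C, forall t, 0 <= K t <= C;
  kernel_mass : (\int[mu]_t (K t)%:E)%E = 1%E;
  kernel_centered : (\int[mu]_t (t * K t)%:E)%E = 0%E;
  kernel_square : (\int[mu]_t (K t ^+ 2)%:E < +oo)%E;
  kernel_moments : forall s, (s <= 3)%N ->
    mu.-integrable setT (fun t => (`|t| ^+ s * K t)%:E) }.

Definition prod_fun M (f : 'I_M -> R -> R) (x : R) : R := \prod_m f m x.

Definition prod_mass M (f : 'I_M -> R -> R) : R := \int[mu]_x prod_fun f x.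

Definition norm_prod M (f : 'I_M -> R -> R) (x : R) : R :=
  (prod_mass f)^-1 * prod_fun f x.

Definition kde (K : R -> R) (N : nat) (h : R) (X : nat -> R) (x : R) : R :=
  (N%:R * h)^-1 * \sum_(i < N) K ((x - X i) / h).

(* When the mass of the product of the estimators vanishes, the factor
   (0 / lambda) ^+ 2 makes the random variable equal to 0. *)
Definition MISE_bar d (T : measurableType d) (P : probability T R) M
    (p : 'I_M -> R -> R) (K : R -> R) (N : 'I_M -> nat) (h : 'I_M -> R)
    (X : 'I_M -> nat -> {RV P >-> R}) : \bar R :=
  let p_hat w m := kde K (N m) (h m) (fun i => X m i w) in
  'E_P[(fun w => (prod_mass (p_hat w) / prod_mass p) ^+ 2 *
    \int[mu]_x (norm_prod (p_hat w) x - norm_prod p x) ^+ 2)%R]%E.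

Definition bias M (p : 'I_M -> R -> R) (K : R -> R) (h : 'I_M -> R)
    (x : R) : R :=
  (prod_mass p)^-1 * abs_moment K 2 / 2 *
  \sum_m h m ^+ 2 * derive1n 2 (p m) x * \prod_(k | k != m) p k x.

Definition var M (p : 'I_M -> R -> R) (N : 'I_M -> nat) (h : 'I_M -> R)
    (x : R) : R :=
  (prod_mass p)^-1 ^+ 2 *
  \sum_m p m x / ((N m)%:R * h m) * \prod_(k | k != m) p k x ^+ 2.

Definition AMISE_bar M (p : 'I_M -> R -> R) (K : R -> R) (N : 'I_M -> nat)
    (h : 'I_M -> R) : R :=
  let B := bias p K h in
  let V := var p N h in
  (\int[mu]_x B x) ^+ 2 * (\int[mu]_x (norm_prod p x) ^+ 2)
  + \int[mu]_x (B x) ^+ 2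
  + (\int[mu]_x V x) * (\int[mu]_t (K t) ^+ 2)
  - 2 * \int[(mu \x mu)%E]_z (B z.2 * B z.1 * norm_prod p z.1).

(* The ratio conditions are required for n > 0 only, since n = 0 would make
   N i n / n equal to 0. *)
Definition scaling M (N : nat -> 'I_M -> nat) (h : nat -> 'I_M -> R) : Prop :=
  [/\ forall n i, (0 < n)%N -> 0 < h n i,
      exists D1 D2 : R, 0 < D1 < D2 /\
        forall n i, (0 < n)%N -> D1 <= (N n i)%:R / n%:R <= D2,
      exists A1 A2 alpha0 : R, [/\ 0 < A1, 0 < A2, 0 < alpha0 < 1 &
        forall n i, (0 < n)%N ->
          A1 * (N n i)%:R `^ (- alpha0) <= h n i
            <= A2 * (N n i)%:R `^ (- alpha0)] &
      forall i, h n i * (N n i)%:R @[n --> \oo] --> +oo].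

Record is_norm M (nrm : 'rV[R]_M -> R) : Prop := IsNorm {
  norm_definite : forall v, nrm v = 0 -> v = 0;
  norm_homogeneous : forall a v, nrm (a *: v) = `|a| * nrm v;
  norm_triangle : forall u v, nrm (u + v) <= nrm u + nrm v }.

End Densities.

(* Main.v *)
Require Import Defs.
From HB Require Import structures.
From mathcomp Require Import all_boot all_order all_algebra finmap.
From mathcomp Require Import all_classical all_reals all_analysis.
From mathcomp Require Import measurable_realfun ring lra.

Set Implicit Arguments.
Unset Strict Implicit.
Unset Printing Implicit Defensive.

Import Order.TTheory GRing.Theory Num.Theory.
Import numFieldNormedType.Exports.

Local Open Scope classical_set_scope.
Local Open Scope ring_scope.

(** Write pi = c p* and let hp* be the product of the kernel estimators, with
    mass hl.  The weight (hl / lambda)^2 cancels the random normalisation, so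
    the random variable under the expectation is
    lambda^-2 int (hp* - hl pi)^2, a quadratic functional of hp*; this remains
    true when hl = 0, since the nonnegative bounded function hp* is then null
    almost everywhere ([riskE]).  Expanding the square and exchanging
    expectation and integrals, only Q(x, y) = E[hp*(x) hp*(y)] matters:

      MISE = lambda^-2 (int Q(x, x) dx - 2 int int pi(x) Q(x, y) dx dy
                         + int pi^2 int int Q)                  ([MISE_barE]).

    By independence Q(x, y) is the product over m of the second moments
    f_m(x) f_m(y) + r_m(x, y) of the estimators, where f_m = K_h * p_m is the
    mean and r_m is the covariance, 1/N_m times (G_m(x, y) - f_m(x) f_m(y))
    with G_m >= 0 of total mass 1 ([expectation_prod_sums]).

    Put H and eta for upper bounds of the h_m and of the 1 / (N_m h_m), and
    F = prod_m f_m.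
    - Replacing every r_m by 0 turns the right-hand side into int (L F)^2, with
      L g = g - (int g) pi.  As L p* = 0, only F - p* counts.  Taylor's formula
      with integral remainder, the vanishing first moment and the third moment
      of K give F - p* = D + O(H^3), with D = lambda B the first-order bias and
      D = O(H^2); so this part is int (L D)^2 + O(H^5) ([bias_expansion]).
      Expanding int (L D)^2 gives the three terms in B of the AMISE.
    - On the diagonal r_m(x, x) is p_m(x) int K^2 / (N_m h_m) up to O(H eta),
      which yields the variance term up to O(H eta + eta^2)
      ([variance_expansion]).
    - Off the diagonal only the L1 norm of r_m is involved; it is O(1 / N_m),
      since G_m has mass 1, and 1 / N_m = h_m / (N_m h_m) is at most H eta
      ([cross_moment_expansion]).

    Hence the error is at most A (H^5 + H eta + eta^2) with A depending only on
    the densities and the kernel ([MISE_bar_expansion]).  Under the scaling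
    assumptions the h_m are comparable with each other, and so are the N_m, so
    by the equivalence of norms H^4 is O(||h||^4) and eta is O(1/(||N|| ||h||)),
    while H and eta tend to 0: the error is a small o ([littleo_error]).

    Every O above is an estimate in the uniform norm and in the L1 norm at once.
    The largest of the two norms is submultiplicative, is invariant under
    translations and dominates integrals of squares, so products, smoothings
    and quadratic forms of the functions involved are all controlled by the
    predicate [l1sup]. *)

(** * Functions that are both bounded and integrable *)

(** The norm of a function in both the uniform norm and L1 is at most [b]. One
    constant for the two norms makes the estimates below calculations in a
    Banach algebra. *)
Definition l1sup d (T : measurableType d) (R : realType)
    (mu : {measure set T -> \bar R}) (f : T -> R) (b : R) : Prop :=
  [/\ measurable_fun setT f, forall x, `|f x| <= b &
      (\int[mu]_x `|f x|%:E <= b%:E)%E].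

Section L1sup.
Context d (T : measurableType d) (R : realType).
Variable mu : {measure set T -> \bar R}.
Implicit Types (f g : T -> R) (a b : R).

Lemma l1sup_ge0 f b : l1sup mu f b -> 0 <= b.
Proof. by case=> _ _ fb; rewrite -lee_fin (le_trans _ fb)// integral_ge0. Qed.

Lemma l1sup_integrable f b : l1sup mu f b -> mu.-integrable setT (EFin \o f).
Proof.
case=> mf _ fb; apply/integrableP; split; first exact/measurable_EFinP.
exact: le_lt_trans fb (ltry _).
Qed.

Lemma l1sup_dominated f g b : measurable_fun setT f ->
  (forall x, `|f x| <= `|g x|) -> l1sup mu g b -> l1sup mu f b.
Proof.
move=> mf fg [mg gb igb]; split=> //; first by move=> x; exact: le_trans (gb x).
apply: le_trans igb; apply: ge0_le_integral => //.
- by apply/measurable_EFinP; exact: measurableT_comp.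
- by apply/measurable_EFinP; exact: measurableT_comp.
- by move=> x _; rewrite lee_fin.
Qed.

Lemma le_l1sup f a b : a <= b -> l1sup mu f a -> l1sup mu f b.
Proof.
move=> ab [mf fa ifa]; split=> //; first by move=> x; exact: le_trans ab.
by apply: le_trans ifa _; rewrite lee_fin.
Qed.

Lemma l1sup_norm f b : l1sup mu f b -> l1sup mu (fun x => `|f x|) b.
Proof.
move=> fb; apply: (l1sup_dominated _ _ fb); last by move=> x; rewrite normr_id.
by case: fb => mf _ _; exact: measurableT_comp.
Qed.

Lemma l1sup0 : l1sup mu (cst 0) 0.
Proof.
split=> // [x|]; first by rewrite normr0.
by under eq_integral do rewrite normr0; rewrite integral0.
Qed.

Lemma l1supD f g a b :
  l1sup mu f a -> l1sup mu g b -> l1sup mu (f \+ g) (a + b).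
Proof.
move=> [mf fa ifa] [mg gb igb]; split; first exact: measurable_funD.
  by move=> x; apply: le_trans (ler_normD _ _) _; rewrite lerD.
have m1 : measurable_fun setT (fun x => `|f x|%:E).
  by apply/measurable_EFinP; exact: measurableT_comp.
have m2 : measurable_fun setT (fun x => `|g x|%:E).
  by apply/measurable_EFinP; exact: measurableT_comp.
apply: (@le_trans _ _ (\int[mu]_x (`|f x|%:E + `|g x|%:E))%E).
  apply: ge0_le_integral => //.
  - apply/measurable_EFinP; apply: measurableT_comp => //.
    exact: measurable_funD.
  - exact: emeasurable_funD.
  - by move=> x _; rewrite -EFinD lee_fin ler_normD.
by rewrite ge0_integralD// EFinD leeD.
Qed.

Lemma l1supM_bounded f g a b : measurable_fun setT f -> 0 <= a ->
  (forall x, `|f x| <= a) -> l1sup mu g b ->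
  l1sup mu (fun x => f x * g x) (a * b).
Proof.
move=> mf a0 fa [mg gb igb]; split; first exact: measurable_funM.
  by move=> x; rewrite normrM ler_pM.
have m2 : measurable_fun setT (fun x => `|g x|%:E).
  by apply/measurable_EFinP; exact: measurableT_comp.
apply: (@le_trans _ _ (\int[mu]_x (a%:E * `|g x|%:E))%E).
  apply: ge0_le_integral => //.
  - apply/measurable_EFinP; apply: measurableT_comp => //.
    exact: measurable_funM.
  - exact: emeasurable_funM.
  - by move=> x _; rewrite -EFinM lee_fin normrM ler_wpM2r.
by rewrite ge0_integralZl// EFinM lee_wpmul2l.
Qed.

Lemma l1supM f g a b :
  l1sup mu f a -> l1sup mu g b -> l1sup mu (fun x => f x * g x) (a * b).
Proof.
move=> fa gb; have [mf fa' _] := fa.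
by apply: l1supM_bounded gb => //; exact: l1sup_ge0 fa.
Qed.

Lemma l1supZ c f b : l1sup mu f b -> l1sup mu (fun x => c * f x) (`|c| * b).
Proof. by move=> fb; apply: l1supM_bounded fb. Qed.

Lemma l1supN f b : l1sup mu f b -> l1sup mu (fun x => - f x) b.
Proof.
move=> fb; apply: (l1sup_dominated _ _ fb); last by move=> x; rewrite normrN.
by case: fb => mf _ _; exact: measurableT_comp.
Qed.

Lemma l1supB f g a b :
  l1sup mu f a -> l1sup mu g b -> l1sup mu (fun x => f x - g x) (a + b).
Proof. by move=> fa gb; apply: l1supD fa _; exact: l1supN. Qed.

Lemma l1sup_sum (I : Type) (s : seq I) (F : I -> T -> R) (B : I -> R) :
  (forall i, l1sup mu (F i) (B i)) ->
  l1sup mu (fun x => \sum_(i <- s) F i x) (\sum_(i <- s) B i).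
Proof.
move=> FB; elim: s => [|i s IH].
  rewrite big_nil (_ : (fun _ => _) = cst 0); first exact: l1sup0.
  by apply/funext => x; rewrite big_nil.
rewrite big_cons (_ : (fun _ => _) = F i \+ (fun x => \sum_(j <- s) F j x)).
  exact: l1supD.
by apply/funext => x; rewrite big_cons.
Qed.

Lemma l1sup_Rintegral f b : l1sup mu f b -> `|\int[mu]_x f x| <= b.
Proof.
move=> fb; have fi := l1sup_integrable fb; case: fb => mf _ ifb.
rewrite -lee_fin EFin_normr_Rintegral//.
apply: le_trans ifb; apply: le_trans (le_abse_integral _ _ _) _ => //.
by case/integrableP : fi.
Qed.

(** The index [i] makes the product non-empty: the empty product is the constant
    1, which is bounded but need not be integrable. *)
Lemma l1sup_prod (I : eqType) (i : I) (s : seq I) (f : I -> T -> R) c :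
  i \in s -> (forall k, l1sup mu (f k) c) ->
  l1sup mu (fun x => \prod_(k <- s) f k x) (c ^+ size s).
Proof.
move=> + fc; elim: s i => // j s IH i _; case: s IH => [_|k s IH].
  rewrite /= expr1 (_ : (fun _ => _) = f j)//.
  by apply/funext => x; rewrite big_seq1.
rewrite (_ : (fun _ => _) = (fun x => f j x * \prod_(k <- k :: s) f k x)).
  by rewrite [size _]/= exprS; apply: l1supM (fc _) (IH k _); rewrite mem_head.
by apply/funext => x; rewrite big_cons.
Qed.

End L1sup.

(** * Product measures and changes of variables *)

Section ProductSpaces.
Context d1 d2 (S : measurableType d1) (T : measurableType d2) (R : realType).
Variables (m1 : {sigma_finite_measure set S -> \bar R})
  (m2 : {sigma_finite_measure set T -> \bar R}).

(** Minkowski's integral inequality: the [l1sup] norm of an integral over a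
    parameter is at most the integral of the [l1sup] norms. Averages of
    translates, smoothings and expectations are all of this form. *)
Lemma minkowski (U : S * T -> R) (v : S -> R) c :
  measurable_fun setT U -> measurable_fun setT v ->
  (forall s, l1sup m2 (fun x => U (s, x)) (v s)) ->
  (\int[m1]_s (v s)%:E <= c%:E)%E ->
  [/\ (m1 \x m2)%E.-integrable setT (EFin \o U),
      forall x, m1.-integrable setT (fun s => (U (s, x))%:E) &
      l1sup m2 (fun x => \int[m1]_s U (s, x)) c].
Proof.
move=> mU mv Uv vc.
have mEU : measurable_fun setT (EFin \o U) by exact/measurable_EFinP.
have mnU : measurable_fun setT (abse \o (EFin \o U)) by exact: measurableT_comp.
have nU0 z : (0 <= (abse \o (EFin \o U)) z)%E by exact: abse_ge0.
have mF : measurable_fun setT (fubini_F m2 (abse \o (EFin \o U))).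
  exact: measurable_fun_fubini_tonelli_F.
have mG : measurable_fun setT (fubini_G m1 (abse \o (EFin \o U))).
  exact: measurable_fun_fubini_tonelli_G.
have mUx x : measurable_fun setT (fun s => U (s, x)).
  by apply: measurableT_comp => //; exact: measurable_pair2.
have mUs s : measurable_fun setT (fun x => U (s, x)).
  by apply: measurableT_comp => //; exact: measurable_pair1.
have mEv : measurable_fun setT (fun s => (v s)%:E) by exact/measurable_EFinP.
have IS : (\int[m1]_s \int[m2]_x `|U (s, x)|%:E <= c%:E)%E.
  apply: le_trans vc; apply: ge0_le_integral => //.
    by move=> s _; exact: integral_ge0.
  by move=> s _; case: (Uv s).
have iU : (m1 \x m2)%E.-integrable setT (EFin \o U).
  apply/integrable12ltyP => //=; exact: le_lt_trans IS (ltry _).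
have bx x : (\int[m1]_s `|U (s, x)|%:E <= c%:E)%E.
  apply: le_trans vc; apply: ge0_le_integral => //.
    by apply/measurable_EFinP; exact: measurableT_comp.
  by move=> s _; rewrite lee_fin; case: (Uv s).
have iUx x : m1.-integrable setT (fun s => (U (s, x))%:E).
  apply/integrableP; split; first exact/measurable_EFinP.
  exact: le_lt_trans (bx x) (ltry _).
have nx x : (`| \int[m1]_s U (s, x) |%:E <= \int[m1]_s `|U (s, x)|%:E)%E.
  rewrite EFin_normr_Rintegral//; last exact: iUx.
  by apply: le_trans (le_abse_integral _ _ _) _ => //; exact/measurable_EFinP.
have mI : measurable_fun setT (fun x => \int[m1]_s U (s, x)).
  by apply: measurableT_comp => //; exact: (measurable_fubini_G iU).
split=> //; split=> //.
- by move=> x; rewrite -lee_fin; apply: le_trans (nx x) (bx x).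
- apply: (@le_trans _ _ (\int[m2]_x \int[m1]_s `|U (s, x)|%:E)%E).
    apply: ge0_le_integral => //.
    by apply/measurable_EFinP; exact: measurableT_comp.
  by rewrite -(fubini_tonelli (abse \o (EFin \o U))).
Qed.

Lemma Rintegral_swap (U : S * T -> R) :
  (m1 \x m2)%E.-integrable setT (EFin \o U) ->
  (forall s, m2.-integrable setT (fun x => (U (s, x))%:E)) ->
  (forall x, m1.-integrable setT (fun s => (U (s, x))%:E)) ->
  [/\ m1.-integrable setT (fun s => (\int[m2]_x U (s, x))%:E),
      \int[m1]_s \int[m2]_x U (s, x) = \int[(m1 \x m2)%E]_z U z &
      \int[m2]_x \int[m1]_s U (s, x) = \int[(m1 \x m2)%E]_z U z].
Proof.
move=> iU i2 i1.
have E1 : (fun s => (\int[m2]_x U (s, x))%:E) = fubini_F m2 (EFin \o U).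
  by apply/funext => s; rewrite fineK//; exact: integrable_fin_num.
have E2 : (fun x => (\int[m1]_s U (s, x))%:E) = fubini_G m1 (EFin \o U).
  by apply/funext => s; rewrite fineK//; exact: integrable_fin_num.
split.
- by rewrite E1; exact: integrable_fubini_F.
- rewrite {1}/Rintegral; congr fine; rewrite -integral12_prod_meas1//.
  exact: (congr1 (fun f => \int[m1]_x f x)%E E1).
- rewrite {1}/Rintegral; congr fine; rewrite -integral21_prod_meas1//.
  exact: (congr1 (fun f => \int[m2]_x f x)%E E2).
Qed.

Lemma l1sup_tensor (f : S -> R) (g : T -> R) a b :
  l1sup m1 f a -> l1sup m2 g b ->
  l1sup (m1 \x m2)%E (fun z => f z.1 * g z.2) (a * b) /\
  \int[(m1 \x m2)%E]_z (f z.1 * g z.2) = (\int[m1]_x f x) * (\int[m2]_y g y).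
Proof.
move=> fa gb; have [mf fa1 fa2] := fa; have [mg gb1 gb2] := gb.
have mU : measurable_fun setT (fun z : S * T => f z.1 * g z.2).
  by apply: measurable_funM; exact: measurableT_comp.
have a0 := l1sup_ge0 fa; have b0 := l1sup_ge0 gb.
have L : l1sup (m1 \x m2)%E (fun z => f z.1 * g z.2) (a * b).
  split=> //; first by move=> z; rewrite normrM ler_pM.
  rewrite (fubini_tonelli1 (fun z => `|f z.1 * g z.2|%:E))//; last first.
    by apply/measurable_EFinP; exact: measurableT_comp.
  have mgn : measurable_fun setT (fun x => `|g x|%:E).
    by apply/measurable_EFinP; exact: measurableT_comp.
  have mfn : measurable_fun setT (fun x => `|f x|%:E).
    by apply/measurable_EFinP; exact: measurableT_comp.
  rewrite /fubini_F/=.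
  under eq_integral => x _.
    under eq_integral => y _ do rewrite normrM EFinM.
    rewrite ge0_integralZl//; over.
  rewrite ge0_integralZr//; last exact: integral_ge0.
  by rewrite EFinM; apply: lee_pmul => //; exact: integral_ge0.
split=> //.
have iU := l1sup_integrable L.
have ifx := l1sup_integrable fa; have igx := l1sup_integrable gb.
have [| |_ <- _] := Rintegral_swap iU.
- by move=> s; exact: (integrableZl measurableT (f s) igx).
- by move=> s; exact: (integrableZr measurableT (g s) ifx).
under eq_Rintegral => x _ do rewrite /= RintegralZl//.
by rewrite RintegralZr.
Qed.

End ProductSpaces.

Section ChangeOfVariables.
Context (R : realType).
Local Notation mu := (@lebesgue_measure R).

(** Both sides are measures, as functions of the set, and they agree on
    intervals. *)
Lemma lebesgue_affine (a b : R) (A : set R) : b != 0 -> measurable A ->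
  mu A = (`|b|%:E * mu ((fun t => a + b * t)%R @^-1` A))%E.
Proof.
move=> b0 mA; have nb : 0 <= `|b| by [].
have mphi' : measurable_fun setT (fun t : R => a + b * t).
  by apply: measurable_funD => //; exact: measurable_funM.
have mphi : @measurable_fun _ _ (measurableTypeR R) (measurableTypeR R) setT
    (fun t => a + b * t) by exact: mphi'.
pose phi : measurableTypeR R -> measurableTypeR R := fun t => a + b * t.
pose nu := mscale (NngNum nb) (pushforward mu phi).
have -> : (`|b|%:E * mu ((fun t => a + b * t)%R @^-1` A))%E = nu mphi A by [].
apply: (@lebesgue_measure_unique R (nu mphi)) => //= _ [[u v]] _ <-.
rewrite /nu /mscale/= /pushforward /phi.
have [bp|bn] := ltP 0 b.
  rewrite (_ : _ @^-1` _ = `](u - a) / b, (v - a) / b]%classic); last first.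
    apply/seteqP; split=> t /=; rewrite !in_itv/= ltr_pdivrMr// ler_pdivlMr//;
      by move=> /andP[? ?]; apply/andP; split; lra.
  rewrite !lebesgue_measure_itv/= !lte_fin ltr_pM2r ?invr_gt0// ltrBlDr subrK.
  case: ifPn => uv; last by rewrite mule0.
  by rewrite -!EFinB -EFinM gtr0_norm//; congr EFin; field.
have bn' : b < 0 by rewrite lt_neqAle b0.
rewrite (_ : _ @^-1` _ = `[(v - a) / b, (u - a) / b[%classic); last first.
  apply/seteqP; split=> t /=; rewrite !in_itv/= ltr_ndivlMr// ler_ndivrMr//;
    by move=> /andP[? ?]; apply/andP; split; lra.
rewrite !lebesgue_measure_itv/= !lte_fin ltr_nM2r ?invr_lt0// ltrBlDr subrK.
case: ifPn => uv; last by rewrite mule0.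
by rewrite -!EFinB -EFinM ltr0_norm//; congr EFin; field.
Qed.

End ChangeOfVariables.

Section Transfer.
Context d1 d2 d3 (S : measurableType d1) (T : measurableType d2)
  (V : measurableType d3) (R : realType).
Variables (m1 : {measure set S -> \bar R}) (m2 : {measure set T -> \bar R}).
Variables (f : S -> V) (g : T -> V) (u : S -> R) (v : T -> R).
Hypotheses (mf : measurable_fun setT f) (mg : measurable_fun setT g).
Hypotheses (mu : measurable_fun setT u) (mv : measurable_fun setT v).
Hypotheses (u0 : forall x, 0 <= u x) (v0 : forall x, 0 <= v x).

Import HBNNSimple.

(** Two image measures of measures with densities that agree on sets agree on
    nonnegative functions, by approximation with simple functions. This one
    statement gives the affine change of variables, the passage from the law of
    a sample to integrals against its density, and the passage from independent
    events to independent functions. *)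
Lemma ge0_integral_indic_eq :
  (forall A, measurable A -> (\int[m1]_x (u x * \1_A (f x))%:E
                            = \int[m2]_x (v x * \1_A (g x))%:E)%E) ->
  forall G : V -> R, measurable_fun setT G -> (forall x, 0 <= G x) ->
  (\int[m1]_x (u x * G (f x))%:E = \int[m2]_x (v x * G (g x))%:E)%E.
Proof.
move=> H G mG G0.
have mEG : measurable_fun setT (EFin \o G) by exact/measurable_EFinP.
pose G_ := nnsfun_approx measurableT mEG.
(* The same reduction to the level sets of simple functions serves for both
   sides, so it is proved for an arbitrary image measure. *)
suff main d (Z : measurableType d) (m : {measure set Z -> \bar R}) (k : Z -> V)
    (w : Z -> R) : measurable_fun setT k -> measurable_fun setT w ->
    (forall x, 0 <= w x) ->
    (\int[m]_x (w x * G (k x))%:E = limn (fun n => \sum_(r \in range (G_ n))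
      r%:E * \int[m]_x (w x * \1_(G_ n @^-1` [set r]) (k x))%:E))%E.
  rewrite !main//; congr (limn _); apply/funext => n.
  by apply: eq_fsbigr => r _; rewrite H.
move=> mk mw w0.
transitivity (limn (fun n => \int[m]_x (w x * G_ n (k x))%:E)%E).
  rewrite -monotone_convergence//.
  - apply: eq_integral => x _; apply/esym/cvg_lim => //.
    suff C : (fun n => (w x)%:E * (G_ n (k x))%:E)%E @ \oo -->
      ((w x)%:E * (G (k x))%:E)%E by exact: C.
    apply: cvgeZl => //.
    exact: (@cvg_nnsfun_approx _ _ _ _ measurableT _ mEG
      (fun x _ => G0 x : (0 <= (G x)%:E)%E) (k x) I).
  - move=> n; apply/measurable_EFinP; apply: measurable_funM => //.
    exact: measurableT_comp.
  - by move=> n x _; rewrite lee_fin mulr_ge0.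
  - move=> x _ i j ij; rewrite lee_fin ler_wpM2l//.
    exact/lefP/nd_nnsfun_approx.
congr (limn _); apply/funext => n.
have mI r : measurable_fun setT (fun x => \1_(G_ n @^-1` [set r]) (k x) : R).
  by apply: measurableT_comp.
transitivity (\int[m]_x \sum_(r \in range (G_ n))
    (r%R * (w x * \1_(G_ n @^-1` [set r]) (k x)))%:E)%E.
  apply: eq_integral => x _; rewrite fsumEFin//; congr EFin.
  rewrite fimfunE mulrC mulr_fsuml//; apply: eq_fsbigr => r _.
  by rewrite mulrAC -mulrA.
rewrite ge0_integral_fsum//.
- apply: eq_fsbigr => r /[!inE] -[y _ <-].
  under eq_integral do rewrite EFinM.
  rewrite ge0_integralZl//; first exact/measurable_EFinP/measurable_funM.
  - by move=> x _; rewrite lee_fin mulr_ge0.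
  - by rewrite lee_fin.
- move=> r; apply/measurable_EFinP; apply: measurable_funM => //.
  exact: measurable_funM.
- move=> r x _; rewrite lee_fin mulrCA mulr_ge0//.
  exact: nnfun_muleindic_ge0.
Qed.

End Transfer.

Section SigmaFiniteProduct.
Context d1 d2 (S : measurableType d1) (T : measurableType d2) (R : realType).
Variables (m1 : {sigma_finite_measure set S -> \bar R})
  (m2 : {sigma_finite_measure set T -> \bar R}).

Let sigma_finite_product : sigma_finite setT (m1 \x m2)%E.
Proof.
have /sigma_finiteP[F [TF ndF Foo]] := sigma_finiteT m1.
have /sigma_finiteP[G [TG ndG Goo]] := sigma_finiteT m2.
exists (fun n => F n `*` G n).
  apply/seteqP; split=> // -[x y] _.
  have [i _ Fx] : (\bigcup_i F i) x by rewrite -TF.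
  have [j _ Gy] : (\bigcup_i G i) y by rewrite -TG.
  exists (maxn i j) => //; split.
    by move: x Fx; exact/subsetPset/ndF/leq_maxl.
  by move: y Gy; exact/subsetPset/ndG/leq_maxr.
move=> n; have [mF Fn] := Foo n; have [mG Gn] := Goo n.
split; first exact: measurableX.
by rewrite product_measure1E// lte_mul_pinfty// ge0_fin_numE.
Qed.

(** The bundled form lets Tonelli's theorem take a product as one of its two
    factors: below, a sample or a parameter varies against a point of the
    plane. *)
Definition sf_product : {sigma_finite_measure set (S * T)%type -> \bar R} :=
  HB.pack_for (SigmaFiniteMeasure.type (S * T)%type R) (product_measure1 m1 m2)
   (@Measure_isSigmaFinite.Build _ _ _ (product_measure1 m1 m2) sigma_finite_product).

End SigmaFiniteProduct.

(** * Taylor's formula in the uniform and L1 norms *)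

Section AveragedTranslates.
Context (R : realType).
Local Notation mu := (@lebesgue_measure R).
Local Notation ind := (\1_(`[0%R, 1%R] : set R) : R -> R).

Lemma FTC01 (F f : R -> R) : (forall s : R, is_derive s 1 F (f s)) -> continuous f ->
  F 1 - F 0 = \int[mu]_s (ind s * f s).
Proof.
move=> dF cf.
have cF : continuous F.
  by move=> s; apply/differentiable_continuous/derivable1_diffP; case: (dF s).
have I01 : (\int[mu]_(s in `[0%R, 1%R]) (f s)%:E = (F 1)%:E - (F 0)%:E)%E.
  apply: continuous_FTC2 => //.
  - exact: continuous_subspaceT.
  - split; first by move=> s _; case: (dF s).
      exact/cvg_at_right_filter/cF.
    exact/cvg_at_left_filter/cF.
  - by move=> s _; rewrite derive1E; case: (dF s).
rewrite /Rintegral (_ : (\int[mu]_s (ind s * f s)%:E)%E =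
  (\int[mu]_(s in `[0%R, 1%R]) (f s)%:E)%E); first by rewrite I01 -EFinB.
rewrite [RHS]integral_mkcond; apply: eq_integral => s _.
rewrite /patch indicE; case: ifPn => _; by rewrite ?mul1r ?mul0r.
Qed.

Lemma ge0_integral_affine (a b : R) (G : R -> R) : b != 0 ->
  measurable_fun setT G -> (forall x, 0 <= G x) ->
  (\int[mu]_x (G x)%:E = \int[mu]_t (`|b| * G (a + b * t))%:E)%E.
Proof.
move=> b0 mG G0.
have mab : measurable_fun setT (fun t : R => a + b * t).
  by apply: measurable_funD => //; exact: measurable_funM.
have := @ge0_integral_indic_eq _ _ _ _ _ R R mu mu id (fun t => a + b * t)
  (cst 1) (cst `|b|) (@measurable_id _ _ _) mab _ _ _ _ _ G mG G0.
move=> /(_ _ _ _ _ _)/= <- //.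
  by apply: eq_integral => x _; rewrite mul1r.
move=> A mA; under eq_integral do rewrite mul1r.
rewrite integral_indic// setIT; transitivity (`|b|%:E * mu ((fun t => a + b * t)%R @^-1` A))%E.
  exact: (lebesgue_affine a b0 mA).
under [RHS]eq_integral do rewrite EFinM.
rewrite ge0_integralZl//; last first.
  by apply/measurable_EFinP; apply: measurableT_comp => //; exact: measurable_indic.
congr (_ * _)%E.
rewrite (_ : (fun t => (\1_A (a + b * t))%:E) =
  (fun t => (\1_((fun t => a + b * t) @^-1` A) t)%:E)) ?integral_indic ?setIT//.
by rewrite -[X in measurable X]setTI; exact: mab.
Qed.

Lemma l1sup_shift (f : R -> R) (a b : R) : l1sup mu f b ->
  l1sup mu (fun x => f (x + a)) b.
Proof.
move=> [mf fb ifb]; have ma : measurable_fun setT (fun x : R => x + a).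
  exact: measurable_funD.
split=> //; first exact: measurableT_comp.
apply: le_trans ifb; rewrite (@ge0_integral_affine a 1 (fun x => `|f x|))//.
  by apply: ge0_le_integral => //; [apply/measurable_EFinP;
    do 2 apply: measurableT_comp => // | apply/measurable_EFinP;
    apply: measurable_funM => //; do 2 apply: measurableT_comp => //;
    apply: measurable_funD => //; exact: measurable_funM
    | move=> x _; rewrite normr1 !mul1r addrC].
exact: measurableT_comp.
Qed.

Lemma measurable_shift (f : R -> R) (g : R * R -> R) : measurable_fun setT f ->
  measurable_fun setT g ->
  measurable_fun setT (fun z : R * R => f (z.2 + g z)).
Proof.
by move=> mf mg; apply: measurableT_comp => //; exact: measurable_funD.
Qed.

(** The integral remainder of Taylor's formula is such an average of translates
    of a derivative. The norm is invariant under translation, so the remainder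
    is bounded by the derivative without any loss, both uniformly and in L1. *)
Lemma l1sup_average (w f : R -> R) (a b : R) : continuous w ->
  (forall s, 0 <= s <= 1 -> `|w s| <= 1) -> l1sup mu f b ->
  l1sup mu (fun x => \int[mu]_s (ind s * (w s * f (x + s * a)))) b.
Proof.
move=> cw w1 fb.
have mf : measurable_fun setT f by case: fb.
have mw : measurable_fun setT w by exact: continuous_measurable_fun.
have mi : measurable_fun setT ind by exact: measurable_indic.
have b0 := l1sup_ge0 fb.
have [] := @minkowski _ _ _ _ R mu mu
  (fun z : R * R => ind z.1 * (w z.1 * f (z.2 + z.1 * a)))
  (fun s => ind s * b) b => //.
- apply: measurable_funM; first exact: (measurableT_comp mi).
  apply: measurable_funM; first exact: (measurableT_comp mw).
  by apply: (@measurable_shift f (fun z => z.1 * a)) => //; exact: measurable_funM.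
- exact: measurable_funM.
- move=> s /=.
  have [s01|s01] := boolP (s \in `[0%R, 1%R]%classic); last first.
    rewrite indicE (negbTE s01) mul0r (_ : (fun _ => _) = cst 0).
      exact: l1sup0.
    by apply/funext => x; rewrite mul0r.
  rewrite indicE s01 mul1r.
  apply: (l1sup_dominated _ _ (l1sup_shift (s * a) fb)).
    apply: measurable_funM => //; apply: measurable_funM => //.
    by apply: measurableT_comp => //; exact: measurable_funD.
  move=> x; rewrite mul1r normrM ler_piMl//; apply: w1.
  by move: s01; rewrite inE/= in_itv.
- under eq_integral do rewrite EFinM.
  rewrite ge0_integralZr//; last by apply/measurable_EFinP.
  have E : mu `[0%R, 1%R]%classic = 1%E.
    by rewrite lebesgue_measure_itv/= lte_fin ltr01 sube0.
  rewrite integral_indic// setIT [X in (X * _ <= _)%E](_ : _ = 1%E) ?mul1e//.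
Qed.

End AveragedTranslates.

Section TaylorRemainder.
Context (R : realType).
Local Notation mu := (@lebesgue_measure R).
Local Notation ind := (\1_(`[0%R, 1%R] : set R) : R -> R).
Variables (p p1 p2 p3 : R -> R).
Hypothesis d0 : forall y : R, is_derive y 1 p (p1 y).

Let shift (f f' : R -> R) : (forall y : R, is_derive y 1 f (f' y)) ->
  forall x a s : R, is_derive s 1 (fun s => f (x + s * a)) (f' (x + s * a) * a).
Proof.
move=> df x a s.
have h : is_derive s 1 (fun s : R => x + s * a) a.
  have h0 : is_derive s 1 (fun s : R => s * a) (s *: 0 + a *: 1).
    exact: (@is_deriveM _ _ id (cst a)).
  have := @is_deriveD _ _ _ (cst x) (fun s : R => s * a) s 1 0 _
    (is_derive_cst x s 1) h0.
  by rewrite scaler0 !add0r -[_ *: _]/(_ * _) mulr1.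
have := @is_derive1_comp R f (fun s => x + s * a) s (f' (x + s * a)) a (df _) h.
by [].
Qed.

Let continuous_shift (f : R -> R) : continuous f ->
  forall x a : R, continuous (fun s : R => f (x + s * a) * a).
Proof.
move=> cf x a s; apply: cvgM; last exact: cvg_cst.
apply: (@continuous_comp _ _ _ (fun s : R => x + s * a) f); last exact: cf.
by apply: cvgD; [exact: cvg_cst|apply: cvgM; [exact: cvg_id|exact: cvg_cst]].
Qed.

Lemma taylor1_l1sup a b : continuous p1 -> l1sup mu p1 b ->
  l1sup mu (fun x => p (x + a) - p x) (`|a| * b).
Proof.
move=> c1 p1b.
have [c0 c01] : continuous (cst 1 : R -> R) /\
    forall s : R, 0 <= s <= 1 -> `|cst 1 s : R| <= 1.
  by split=> [s|s _]; [exact: cst_continuous | rewrite normr1].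
rewrite (_ : (fun _ => _) = fun x =>
    \int[mu]_s (ind s * (cst 1 s * (a * p1 (x + s * a))))).
  exact: (@l1sup_average R (cst 1) (fun y => a * p1 y) _ _ c0 c01 (l1supZ a p1b)).
apply/funext => x.
have := @FTC01 R (fun s : R => p (x + s * a)) (fun s => p1 (x + s * a) * a)
  (shift d0 x a).
rewrite mul1r mul0r addr0 => ->.
  by apply: eq_Rintegral => s _; rewrite mul1r (mulrC a).
by apply: continuous_shift.
Qed.

Hypothesis d1 : forall y : R, is_derive y 1 p1 (p2 y).
Hypothesis d2 : forall y : R, is_derive y 1 p2 (p3 y).

Lemma taylor3_l1sup a b : continuous p3 -> l1sup mu p3 b ->
  l1sup mu (fun x => p (x + a) - (p x + a * p1 x + a ^+ 2 / 2 * p2 x))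
    (`|a| ^+ 3 * b).
Proof.
move=> c3 p3b.
(* The Taylor sum of order 2 about x + s a, evaluated at x + a, is a function
   of s whose derivative telescopes to w(s) a^3 p3(x + s a). *)
pose w (s : R) := (1 - s) ^+ 2 / 2.
have cw : continuous w.
  move=> s; apply: cvgM; last exact: cvg_cst.
  by apply: (@cvgM _ _ _ _ (fun s : R => 1 - s) (fun s : R => 1 - s)); apply: cvgB;
    [exact: cvg_cst|exact: cvg_id|exact: cvg_cst|exact: cvg_id].
have w1 s : 0 <= s <= 1 -> `|w s| <= 1.
  move=> /andP[s0 s1]; rewrite ger0_norm/w; nra.
rewrite (_ : (fun _ => _) = fun x =>
    \int[mu]_s (ind s * (w s * (a ^+ 3 * p3 (x + s * a))))).
  rewrite -normrX.
  exact: (@l1sup_average R w (fun y => a ^+ 3 * p3 y) _ _ cw w1 (l1supZ _ p3b)).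
apply/funext => x.
have := @FTC01 R (fun s : R => p (x + s * a) + ((1 - s) * (a * p1 (x + s * a))
                 + w s * (a ^+ 2 * p2 (x + s * a))))
  (fun s : R => w s * (a ^+ 3 * p3 (x + s * a))).
rewrite mul1r mul0r addr0 /w subrr subr0 => H.
apply: etrans (H _ _); first by field.
  move=> s.
  have h0 := shift d0 x a s; have h1 := shift d1 x a s.
  have h2 := shift d2 x a s.
  have hl : is_derive s 1 (fun s : R => 1 - s) (- 1).
    have := @is_deriveB _ _ _ (cst (1 : R)) id s 1 0 1 _ _.
    rewrite sub0r; exact.
  have hm (f : R -> R) (df c : R) : is_derive s 1 f df ->
      is_derive s 1 (fun s => c * f s) (c * df).
    move=> hf; have := @is_deriveZ _ _ _ f c s 1 df hf; exact.
  have hM (f g : R -> R) (df dg : R) : is_derive s 1 f df ->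
      is_derive s 1 g dg -> is_derive s 1 (fun s => f s * g s) (f s * dg + g s * df).
    move=> hf hg; have := @is_deriveM _ _ f g s 1 df dg hf hg; exact.
  have hD (f g : R -> R) (df dg : R) : is_derive s 1 f df ->
      is_derive s 1 g dg -> is_derive s 1 (fun s => f s + g s) (df + dg).
    move=> hf hg; have := @is_deriveD _ _ _ f g s 1 df dg hf hg; exact.
  have hw : is_derive s 1 (fun s : R => (1 - s) ^+ 2 / 2) (- (1 - s)).
    have := hm _ _ (2^-1) (hM _ _ _ _ hl hl).
    rewrite (_ : (fun _ => _) = (fun s : R => (1 - s) ^+ 2 / 2)); last first.
      by apply/funext => u; rewrite expr2 mulrC.
    by rewrite (_ : 2^-1 * _ = - (1 - s))//; field.
  have := hD _ _ _ _ h0 (hD _ _ _ _ (hM _ _ _ _ hl (hm _ _ a h1))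
    (hM _ _ _ _ hw (hm _ _ (a ^+ 2) h2))).
  set l := (X in is_derive _ _ _ X -> _); set r := (X in _ -> is_derive _ _ _ X).
  by rewrite (_ : l = r)// /l /r; field.
move=> s; apply: cvgM; first exact: cw.
apply: cvgM; first exact: cvg_cst.
apply: (@continuous_comp _ _ _ (fun s : R => x + s * a) p3); last exact: c3.
by apply: cvgD; [exact: cvg_cst|apply: cvgM; [exact: cvg_id|exact: cvg_cst]].
Qed.

End TaylorRemainder.

(** * Convolution with a dilated kernel *)

Section Smoothing.
Context (R : realType).
Local Notation mu := (@lebesgue_measure R).
Variables (k : R -> R).
Hypotheses (mk : measurable_fun setT k) (k0 : forall t, 0 <= k t).

(** The convolution of [p] with the kernel of mass-preserving dilation
    k(. / h) / h, after the substitution that removes the singular factor. *)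
Definition smooth (h : R) (p : R -> R) (x : R) : R :=
  \int[mu]_t (k t * p (x - h * t)).

Let weighted_l1sup (U : R * R -> R) (w : R -> R) (b c : R) :
  measurable_fun setT U -> measurable_fun setT w -> (forall t, 0 <= w t) ->
  0 <= b ->
  (forall t, l1sup mu (fun x => U (t, x)) (w t * b)) ->
  (\int[mu]_t (k t * w t)%:E <= c%:E)%E ->
  (forall x, mu.-integrable setT (fun t => (k t * U (t, x))%:E)) /\
  l1sup mu (fun x => \int[mu]_t (k t * U (t, x))) (c * b).
Proof.
move=> mU mw w0 b0 Uw kwc.
have [] := @minkowski _ _ _ _ R mu mu (fun z : R * R => k z.1 * U z)
  (fun t => k t * w t * b) (c * b) => //.
- by apply: measurable_funM => //; exact: measurableT_comp.
- by apply: measurable_funM => //; exact: measurable_funM.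
- by move=> t /=; rewrite -mulrA -{2}(ger0_norm (k0 t)); exact: l1supZ.
- under eq_integral do rewrite EFinM.
  rewrite ge0_integralZr//.
  + by rewrite EFinM lee_wpmul2r.
  + by apply/measurable_EFinP; exact: measurable_funM.
  + by move=> t _; rewrite lee_fin mulr_ge0.
Qed.

Let measurable_U (p : R -> R) h : measurable_fun setT p ->
  measurable_fun setT (fun z : R * R => p (z.2 - h * z.1)).
Proof.
move=> mp; apply: (@measurable_shift R p (fun z => - (h * z.1))) => //.
by apply: measurableT_comp => //; exact: measurable_funM.
Qed.

Lemma smooth_l1sup h p b c : (\int[mu]_t (k t)%:E <= c%:E)%E ->
  l1sup mu p b ->
  (forall x, mu.-integrable setT (fun t => (k t * p (x - h * t))%:E)) /\
  l1sup mu (smooth h p) (c * b).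
Proof.
move=> kc pb; apply: (@weighted_l1sup (fun z => p (z.2 - h * z.1)) (cst 1)) => //.
- by apply: measurable_U; case: pb.
- exact: l1sup_ge0 pb.
- by move=> t /=; rewrite mul1r; exact: (l1sup_shift (- (h * t)) pb).
- by under eq_integral do rewrite mulr1.
Qed.

Lemma smooth_ge0 h p x : (forall y, 0 <= p y) -> 0 <= smooth h p x.
Proof. by move=> p0; apply: Rintegral_ge0 => t _; rewrite mulr_ge0. Qed.

Variables (p p1 p2 p3 : R -> R) (b : R).
Hypotheses (ik : mu.-integrable setT (EFin \o k)) (pb : l1sup mu p b).
Hypothesis d0 : forall y : R, is_derive y 1 p (p1 y).

Let kc : (\int[mu]_t (k t)%:E <= (\int[mu]_t k t)%:E)%E.
Proof. by rewrite fineK//; exact: integrable_fin_num ik. Qed.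

(** Used with the squared kernel, which has a first absolute moment only through
    the boundedness of the kernel; one derivative of [p] then suffices. *)
Lemma smooth_bias1 h c b1 : 0 <= h -> continuous p1 -> l1sup mu p1 b1 ->
  (\int[mu]_t (k t * `|t|)%:E <= c%:E)%E ->
  l1sup mu (fun x => smooth h p x - (\int[mu]_t k t) * p x) (c * (h * b1)).
Proof.
move=> h0 c1 p1b1 kc1.
have mp : measurable_fun setT p by case: pb.
have [] := @weighted_l1sup (fun z => p (z.2 - h * z.1) - p z.2)
  (fun t => `|t|) (h * b1) c _ _ _ _ _ kc1.
- by apply: measurable_funB; [exact: measurable_U|exact: measurableT_comp].
- exact: measurableT_comp.
- by [].
- rewrite mulr_ge0//. exact: l1sup_ge0 p1b1.
- move=> t /=.
  rewrite (_ : `|t| * (h * b1) = `|- (h * t)| * b1).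
    exact: (taylor1_l1sup d0 _ c1 p1b1).
  by rewrite normrN normrM (ger0_norm h0); ring.
move=> _; rewrite (_ : (fun _ => _) =
  (fun x => smooth h p x - (\int[mu]_t k t) * p x))//.
apply/funext => x; rewrite -RintegralZr//.
have [/(_ x) i1 _] := smooth_l1sup h kc pb.
rewrite -RintegralB//; last exact: (integrableZr measurableT (p x) ik).
by apply: eq_Rintegral => t _ /=; rewrite mulrBr.
Qed.

Hypothesis d1 : forall y : R, is_derive y 1 p1 (p2 y).
Hypothesis d2 : forall y : R, is_derive y 1 p2 (p3 y).

(** The bias of a kernel estimator. Integrating Taylor's formula at the
    increment - h t against the kernel, the term in p' disappears with the
    first moment and the remainder costs the third absolute moment. *)
Lemma smooth_bias3 h c b3 : 0 <= h -> continuous p3 -> l1sup mu p3 b3 ->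
  measurable_fun setT p1 -> measurable_fun setT p2 ->
  mu.-integrable setT (fun t => (t * k t)%:E) ->
  mu.-integrable setT (fun t => (t ^+ 2 * k t)%:E) ->
  \int[mu]_t (t * k t) = 0 ->
  (\int[mu]_t (k t * `|t| ^+ 3)%:E <= c%:E)%E ->
  l1sup mu (fun x => smooth h p x - ((\int[mu]_t k t) * p x +
      h ^+ 2 * ((\int[mu]_t (t ^+ 2 * k t)) / 2) * p2 x)) (c * (h ^+ 3 * b3)).
Proof.
move=> h0 c3 p3b mp1 mp2 i1 i2 m1 kc3.
have mp : measurable_fun setT p by case: pb.
have [] := @weighted_l1sup (fun z => p (z.2 - h * z.1) - (p z.2 +
    (- (h * z.1)) * p1 z.2 + (- (h * z.1)) ^+ 2 / 2 * p2 z.2))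
  (fun t => `|t| ^+ 3) (h ^+ 3 * b3) c _ _ _ _ _ kc3.
- have mN : measurable_fun setT (fun z : R * R => - (h * z.1)).
    by apply: measurableT_comp => //; exact: measurable_funM.
  apply: measurable_funB; first exact: measurable_U.
  apply: measurable_funD; first apply: measurable_funD.
  + exact: measurableT_comp.
  + by apply: measurable_funM => //; exact: measurableT_comp.
  + apply: measurable_funM; last exact: measurableT_comp.
    by apply: measurable_funM => //; exact: measurable_funX.
- by apply: measurable_funX.
- by move=> t; rewrite exprn_ge0.
- by rewrite mulr_ge0 ?exprn_ge0//; exact: l1sup_ge0 p3b.
- move=> t /=.
  rewrite (_ : `|t| ^+ 3 * (h ^+ 3 * b3) = `|- (h * t)| ^+ 3 * b3).
    exact: (taylor3_l1sup d0 d1 d2 _ c3 p3b).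
  by rewrite normrN normrM (ger0_norm h0); ring.
move=> _; rewrite (_ : (fun _ => _) =
  (fun x => smooth h p x - ((\int[mu]_t k t) * p x +
      h ^+ 2 * ((\int[mu]_t (t ^+ 2 * k t)) / 2) * p2 x)))//.
apply/funext => x.
have [/(_ x) j0 _] := smooth_l1sup h kc pb.
have j1 : mu.-integrable setT (EFin \o (fun t => p x * k t)).
  exact: (integrableZl measurableT (p x) ik).
have j2 : mu.-integrable setT (EFin \o (fun t => (- h * p1 x) * (t * k t))).
  exact: (integrableZl measurableT (- h * p1 x) i1).
have j3 : mu.-integrable setT
    (EFin \o (fun t => (h ^+ 2 / 2 * p2 x) * (t ^+ 2 * k t))).
  exact: (integrableZl measurableT (h ^+ 2 / 2 * p2 x) i2).
transitivity (\int[mu]_t (k t * p (x - h * t) - (p x * k t +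
    ((- h * p1 x) * (t * k t) + (h ^+ 2 / 2 * p2 x) * (t ^+ 2 * k t))))).
  by apply: eq_Rintegral => t _ /=; ring.
have j23 := integrableD measurableT j2 j3.
have j123 := integrableD measurableT j1 j23.
rewrite RintegralB// RintegralD// RintegralD// !RintegralZl// m1.
by rewrite /smooth; ring.
Qed.

End Smoothing.

(** * Expansion of products *)

Section Products.
Context (R : realFieldType) (I : eqType).
Implicit Types (a b : I -> R) (s : seq I) (c : R).

Lemma norm_prod_le s a c : (forall i, `|a i| <= c) ->
  `|\prod_(i <- s) a i| <= c ^+ size s.
Proof.
move=> ac; elim: s => [|i s IH]; first by rewrite big_nil normr1.
by rewrite big_cons normrM exprS ler_pM.
Qed.

(** Telescoping: change one factor at a time. *)
Lemma prod_diff1 s a b c : 1 <= c ->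
  (forall i, `|a i| <= c) -> (forall i, `|b i| <= c) ->
  `|\prod_(i <- s) a i - \prod_(i <- s) b i|
    <= c ^+ size s * \sum_(i <- s) `|a i - b i|.
Proof.
move=> c1 ac bc; have c0 : 0 <= c by apply: le_trans c1.
elim: s => [|i s IH]; first by rewrite !big_nil subrr normr0 mulr0.
rewrite !big_cons; set A := \prod_(j <- s) a j in IH *.
set B := \prod_(j <- s) b j in IH *.
have -> : a i * A - b i * B = (a i - b i) * A + b i * (A - B) by ring.
apply: le_trans (ler_normD _ _) _; rewrite !normrM mulrDr lerD//.
  rewrite mulrC ler_wpM2r//; apply: le_trans (norm_prod_le s ac) _.
  by rewrite exprS ler_peMl// exprn_ge0.
by rewrite exprS -mulrA ler_pM.
Qed.

(** The derivative of a product, with a quadratic remainder: peeling off a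
    factor leaves (a_i - b_i) times a first-order difference. *)
Lemma prod_diff2 s a b c : uniq s -> 1 <= c ->
  (forall i, `|a i| <= c) -> (forall i, `|b i| <= c) ->
  `|\prod_(i <- s) a i - \prod_(i <- s) b i
      - \sum_(i <- s) (a i - b i) * \prod_(k <- s | k != i) b k|
    <= c ^+ size s * (\sum_(i <- s) `|a i - b i|) ^+ 2.
Proof.
move=> + c1 ac bc; have c0 : 0 <= c by apply: le_trans c1.
elim: s => [_|i s IH].
  by rewrite !big_nil !subrr normr0 expr0n/= mulr0.
move=> /= /andP[iNs us]; have D1 := prod_diff1 s c1 ac bc.
have {}IH := IH us; rewrite !big_cons eqxx/=.
have -> : \prod_(k <- s | k != i) b k = \prod_(k <- s) b k.
  rewrite big_seq_cond [RHS]big_seq; apply: eq_bigl => k.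
  by case: (eqVneq k i) => [->|]; rewrite ?(negbTE iNs)// andbT.
have -> : \sum_(j <- s) (a j - b j) * \prod_(k <- i :: s | k != j) b k =
    b i * \sum_(j <- s) (a j - b j) * \prod_(k <- s | k != j) b k.
  rewrite mulr_sumr; apply: eq_big_seq => j js; rewrite big_cons.
  have -> : i != j by apply: contraNneq iNs => ->.
  by rewrite mulrCA.
set A := \prod_(j <- s) a j in D1 IH *.
set B := \prod_(j <- s) b j in D1 IH *.
set D := \sum_(j <- s) _ * _ in IH *.
set S := \sum_(j <- s) `|_| in D1 IH *.
have -> : a i * A - b i * B - ((a i - b i) * B + b i * D)
  = (a i - b i) * (A - B) + b i * (A - B - D) by ring.
apply: le_trans (ler_normD _ _) _; rewrite !normrM.
have S0 : 0 <= S by apply: sumr_ge0.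
have d0 := normr_ge0 (a i - b i); set d := `|a i - b i| in d0 *.
have cs0 : 0 <= c ^+ size s by rewrite exprn_ge0.
apply: (@le_trans _ _ (d * (c ^+ size s * S) + c * (c ^+ size s * S ^+ 2))).
  by rewrite lerD// ler_pM.
rewrite (exprS c (size s)); set q := c ^+ size s in cs0 *.
have dS : 0 <= d * S by rewrite mulr_ge0.
rewrite -subr_ge0.
have -> : c * q * (d + S) ^+ 2 - (d * (q * S) + c * (q * S ^+ 2)) =
  q * (c * d ^+ 2 + (2 * c - 1) * (d * S)) by ring.
rewrite mulr_ge0// addr_ge0// ?mulr_ge0// ?exprn_ge0//; lra.
Qed.

End Products.

(** * Moments of products of independent samples *)
Section Independence.
Context d (T : measurableType d) (R : realType) (P : probability T R).
Context (I : choiceType) (D : set I) (X : I -> {RV P >-> R}).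
Hypothesis indX : mutually_independent D X.

Lemma prod_indic (s : seq I) (A : I -> set R) w :
  \prod_(i <- s) \1_(A i) (X i w) =
  \1_(\bigcap_(i in [set` s]) X i @^-1` A i) w :> R.
Proof.
rewrite indicE.
have [/set_mem sA|/negP nsA] := boolP (w \in _).
  rewrite big_seq big1// => i si; rewrite indicE mem_set//.
  exact: sA.
apply/eqP; rewrite prodf_seq_eq0.
apply/negPn/negP => /hasPn H; apply: nsA; apply/mem_set => i /= si.
have := H _ si; rewrite /= indicE.
by case: (boolP (X i w \in A i)) => [/set_mem//|]; rewrite eqxx.
Qed.

(** Interpolates between independent events ([s1] empty, which is the hypothesis)
    and independent functions ([s2] empty), turning one indicator at a time into
    a function. *)
Lemma expectation_prod_indic (s1 s2 : seq I) (g : I -> R -> R)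
    (C : R) (A : I -> set R) :
  uniq (s1 ++ s2) -> (forall i, i \in s1 ++ s2 -> D i) ->
  (forall i, measurable_fun setT (g i)) -> (forall i x, 0 <= g i x <= C) ->
  (forall i, measurable (A i)) ->
  (\int[P]_w (\prod_(i <- s1) g i (X i w) * \prod_(i <- s2) \1_(A i) (X i w))%:E
   = \prod_(i <- s1) \int[P]_w (g i (X i w))%:E *
     \prod_(i <- s2) P (X i @^-1` A i))%E.
Proof.
move=> + + mg gC.
have g0 i x : 0 <= g i x by case/andP: (gC i x).
elim: s1 s2 A => [|k s1 IH] s2 A us sD mA.
  rewrite big_nil mul1e; pose J := seq_fset tt s2.
  have mXA i : measurable (X i @^-1` A i).
    by rewrite -[X in measurable X]setTI; exact: measurable_funP.
  have JD : [set` J] `<=` D.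
    by move=> i /=; rewrite seq_fsetE => ?; exact: sD.
  have := indX JD (fun i _ => mA i).
  have pJ : perm_eq J s2.
    by apply: uniq_perm => //; exact: seq_fsetE.
  rewrite (perm_big _ pJ)/= => <-.
  under eq_integral => w _ do rewrite big_nil mul1r prod_indic.
  rewrite integral_indic//.
    rewrite setIT; congr (P _); apply: eq_bigcapl.
    by split=> i /=; rewrite seq_fsetE.
  by apply: fin_bigcap_measurable => // i _; exact: mXA.
have mW : measurable_fun setT (fun w => \prod_(i <- s1) g i (X i w) *
    \prod_(i <- s2) \1_(A i) (X i w)).
  apply: measurable_funM; apply: measurable_prod => i _.
    by apply: measurableT_comp.
  by apply: measurableT_comp => //; exact: measurable_indic.
have W0 w : 0 <= \prod_(i <- s1) g i (X i w) * \prod_(i <- s2) \1_(A i) (X i w) :> R.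
  by rewrite mulr_ge0// prodr_ge0// => i _; rewrite indicE.
have perm_s : perm_eq (k :: s1 ++ s2) (s1 ++ k :: s2).
  by rewrite perm_sym; apply/permPl; exact: (perm_catCA s1 [:: k] s2).
have kNs2 : k \notin s2.
  by move: us; rewrite cat_cons /= mem_cat negb_or => /andP[/andP[]].
have us' : uniq (s1 ++ s2) by move: us => /= /andP[].
have mc : measurable_fun setT (fun _ : T => 1 : R) by [].
pose c := (\prod_(i <- s1) \int[P]_w (g i (X i w))%:E *
     \prod_(i <- s2) P (X i @^-1` A i))%E.
have cE : c = (\int[P]_w (\prod_(i <- s1) g i (X i w) *
    \prod_(i <- s2) \1_(A i) (X i w))%:E)%E.
  by rewrite IH// => i si; apply: sD; rewrite cat_cons inE si orbT.
have c0 : (0 <= c)%E by rewrite cE; apply: integral_ge0 => w _; rewrite lee_fin.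
have cfin : c = (fine c)%:E.
  rewrite fineK// cE ge0_fin_numE; last first.
    by apply: integral_ge0 => w _; rewrite lee_fin.
  apply: (@le_lt_trans _ _ (\int[P]_w (C ^+ size s1)%:E)%E); last first.
    rewrite integral_cst// [X in (_ * X < _)%E](_ : _ = 1%E) ?mule1 ?ltry//.
    exact: probability_setT.
  apply: ge0_le_integral => //.
  - by move=> w _; rewrite lee_fin.
  - exact/measurable_EFinP.
  - move=> w _; rewrite lee_fin -[leRHS]mulr1 ler_pM//.
    + by rewrite prodr_ge0.
    + by rewrite prodr_ge0// => i _; rewrite indicE.
    + rewrite -[leLHS]ger0_norm ?prodr_ge0//; apply: norm_prod_le => i.
      by rewrite ger0_norm//; case/andP: (gC i (X i w)).
    + rewrite prod_indic indicE; by case: (_ \in _).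
rewrite big_cons -muleA -/c cfin.
transitivity (\int[P]_w (fine c * g k (X k w))%:E)%E; last first.
  under eq_integral do rewrite EFinM.
  rewrite ge0_integralZl//.
  - by rewrite muleC.
  - by apply/measurable_EFinP; exact: measurableT_comp.
  - by move=> w _; rewrite lee_fin.
  - by rewrite -cfin.
transitivity (\int[P]_w ((\prod_(i <- s1) g i (X i w) *
    \prod_(i <- s2) \1_(A i) (X i w)) * g k (X k w))%:E)%E.
  by apply: eq_integral => w _; rewrite big_cons -mulrA mulrC.
have fc0 : forall w : T, 0 <= cst (fine c) w by move=> w; exact: fine_ge0.
(* The law of X_k weighted by the remaining product and the law of X_k times
   the constant c agree on every set B, by the induction hypothesis with the
   indicator of B attached to k; hence they agree on the function g k. *)
apply: (@ge0_integral_indic_eq _ _ _ _ _ _ R P P (X k) (X k) _ (cst (fine c))) => //.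
move=> B mB; pose A' j := if j == k then B else A j.
have mA' i : measurable (A' i) by rewrite /A'; case: ifP.
transitivity (\int[P]_w (\prod_(i <- s1) g i (X i w) *
    \prod_(i <- k :: s2) \1_(A' i) (X i w))%:E)%E.
  apply: eq_integral => w _; rewrite big_cons {1}/A' eqxx -mulrA.
  congr EFin; congr *%R; rewrite mulrC; congr *%R.
  apply: eq_big_seq => i is2.
  by rewrite /A'; case: eqVneq => // ik; rewrite -ik is2 in kNs2.
rewrite IH//.
- rewrite big_cons {1}/A' eqxx muleCA.
  rewrite (@eq_big_seq _ _ _ _ s2 (fun i => P (X i @^-1` A' i))
    (fun i => P (X i @^-1` A i))); last first.
    move=> i is2; rewrite /A'; case: eqVneq => // ik.
    by rewrite -ik is2 in kNs2.
  rewrite -/c cfin; under [RHS]eq_integral do rewrite /= EFinM.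
  have mi : measurable_fun setT (fun w => (\1_B (X k w))%:E : \bar R).
    apply/measurable_EFinP.
    by apply: (@measurableT_comp _ _ _ _ _ _ (\1_B : R -> R) _ (X k)).
  rewrite (ge0_integralZl _ _ mi)//.
  rewrite muleC; congr (_ * _)%E.
  have mXB : measurable (X k @^-1` B).
    by rewrite -[X in measurable X]setTI; exact: measurable_funP.
  have := @integral_indic _ _ _ P setT measurableT _ mXB.
  by rewrite setIT => <-.
- by rewrite -cfin.
- by rewrite -(perm_uniq perm_s).
- by move=> i; rewrite -(perm_mem perm_s); exact: sD.
Qed.

Lemma expectation_prod (s : seq I) (g : I -> R -> R) (C : R) :
  uniq s -> (forall i, i \in s -> D i) ->
  (forall i, measurable_fun setT (g i)) -> (forall i x, 0 <= g i x <= C) ->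
  (\int[P]_w (\prod_(i <- s) g i (X i w))%:E
   = \prod_(i <- s) \int[P]_w (g i (X i w))%:E)%E.
Proof.
move=> us sD mg gC.
have := @expectation_prod_indic s [::] g C (fun=> setT).
rewrite cats0 big_nil mule1 => <- //.
by apply: eq_integral => w _; rewrite big_nil mulr1.
Qed.
End Independence.

Section SampleMoments.
Context d (T : measurableType d) (R : realType) (P : probability T R).
Local Notation mu := (@lebesgue_measure R).
Context (M : nat) (p : 'I_M -> R -> R) (N : 'I_M -> nat)
  (X : 'I_M -> nat -> {RV P >-> R}).
Hypothesis hpdf : forall m, is_pdf (p m).
Hypothesis hX : sample p N X.

Lemma pdf_integrable m : mu.-integrable setT (EFin \o p m).
Proof.
have [mp p0 p1] := hpdf m; apply/integrableP; split; first exact/measurable_EFinP.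
under eq_integral do rewrite /= ger0_norm//.
by rewrite p1 ltry.
Qed.

Lemma expectation_density m i (G : R -> R) C : (i < N m)%N ->
  measurable_fun setT G -> (forall x, 0 <= G x <= C) ->
  (\int[P]_w (G (X m i w))%:E = (\int[mu]_u (p m u * G u))%:E)%E.
Proof.
move=> iN mG gC; have [mp p0 p1] := hpdf m.
have G0 x : 0 <= G x by case/andP: (gC x).
have pG : mu.-integrable setT (EFin \o (fun u => p m u * G u)).
  apply: (le_integrable measurableT _ _ (integrableZl measurableT C (pdf_integrable m))).
    by apply/measurable_EFinP; exact: measurable_funM.
  move=> x _; rewrite lee_fin !normrM mulrC ler_wpM2r//.
  rewrite ger0_norm//; case/andP: (gC x) => _ h.
  exact: le_trans h (ler_norm _).
rewrite fineK; last exact: (integrable_fin_num measurableT pG).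
transitivity (\int[P]_w (cst 1 w * G (X m i w))%:E)%E.
  by apply: eq_integral => w _; rewrite mul1r.
apply: (@ge0_integral_indic_eq _ _ _ _ _ _ R P mu (X m i) id (cst 1) (p m)) => //.
move=> A mA; have := hX.1 m i iN A mA.
have mXA : measurable (X m i @^-1` A).
  by rewrite -[X in measurable X]setTI; exact: measurable_funP.
under eq_integral do rewrite /= mul1r.
have := @integral_indic _ _ _ P setT measurableT _ mXA.
rewrite setIT => ->; rewrite /distribution/= /pushforward => ->.
rewrite integral_mkcond; apply: eq_integral => x _.
rewrite /patch indicE; case: ifPn => _; by rewrite ?mulr1 ?mulr0.
Qed.

Variables (a b : 'I_M -> R -> R) (C : R).
Hypotheses (ma : forall m, measurable_fun setT (a m))
  (mb : forall m, measurable_fun setT (b m)).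
Hypotheses (aC : forall m x, 0 <= a m x <= C) (bC : forall m x, 0 <= b m x <= C).

Let a0 m x : 0 <= a m x. Proof. by case/andP: (aC m x). Qed.
Let b0 m x : 0 <= b m x. Proof. by case/andP: (bC m x). Qed.

Let Ep m (G : R -> R) : R := \int[mu]_u (p m u * G u).

(** [f] selects one pair of sample indices for each of the [M] samples. *)
Let expectation_pairs (f : 'I_M -> nat * nat) :
  (forall m, ((f m).1 < N m)%N && ((f m).2 < N m)%N) ->
  (\int[P]_w (\prod_m (a m (X m (f m).1 w) * b m (X m (f m).2 w)))%:E =
  (\prod_m (if (f m).1 == (f m).2 then Ep m (fun u => a m u * b m u)
           else Ep m (a m) * Ep m (b m)))%:E)%E.
Proof.
move=> fN.
(* The pair of sample m contributes one variable when its two indices are equal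
   and two when they differ, so that the list s has no repetition and
   independence applies to it. *)
pose t m := if (f m).1 == (f m).2 then [:: (f m).1] else [:: (f m).1; (f m).2].
pose s := [seq (m, l) | m <- index_enum 'I_M, l <- t m].
pose g (k : 'I_M * nat) (z : R) := if (f k.1).1 == (f k.1).2
  then a k.1 z * b k.1 z else if k.2 == (f k.1).1 then a k.1 z else b k.1 z.
have tN m l : l \in t m -> (l < N m)%N.
  rewrite /t; case: ifP => _; rewrite !inE.
    by move=> /eqP ->; case/andP: (fN m).
  by move=> /orP[|] /eqP ->; case/andP: (fN m).
have us : uniq s.
  apply: allpairs_uniq_dep; first exact: index_enum_uniq.
    by move=> m _; rewrite /t; case: ifPn => //= h; rewrite inE andbT.
  by move=> [m l] [m' l'] _ _ /= [-> ->].
have sN i : i \in s -> [set k : 'I_M * nat | (k.2 < N k.1)%N] i.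
  by case/allpairsPdep => m [l [_ lt ->]] /=; exact: tN.
have mab m : measurable_fun setT (fun z => a m z * b m z).
  exact: measurable_funM.
have mg k : measurable_fun setT (g k).
  by rewrite /g; case: (_.1 == _.2) => //; case: (k.2 == _).
have C0 (m : 'I_M) : 0 <= C by case/andP: (aC m 0) => a1 a2; exact: le_trans a2.
have gC k z : 0 <= g k z <= C * C + C.
  have /andP[A0 A1] := aC k.1 z; have /andP[B0 B1] := bC k.1 z.
  have c0 := C0 k.1; clear C0.
  by rewrite /g; case: ifP => _; [|case: ifP => _]; apply/andP; split; nra.
transitivity (\int[P]_w (\prod_(i <- s) g i (X i.1 i.2 w))%:E)%E.
  apply: eq_integral => w _; congr EFin; rewrite /s big_allpairs_dep/=.
  apply: eq_bigr => m _; rewrite /t /g/=; have [e|ne] := eqVneq (f m).1 (f m).2.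
    by rewrite big_seq1 /= e.
  by rewrite big_cons big_seq1/= eqxx eq_sym (negbTE ne).
rewrite (expectation_prod hX.2 us sN mg gC) /s big_allpairs_dep/= -prodEFin.
apply: eq_bigr => m _.
have /andP[f1 f2] := fN m.
rewrite /t /g/=; have [e|ne] := eqVneq (f m).1 (f m).2.
  rewrite big_seq1 /= (@expectation_density _ _ (fun u => a m u * b m u) (C * C))//.
  by move=> x; clear C0; have /andP[A0 A1] := aC m x; have /andP[B0 B1] := bC m x;
    apply/andP; split; nra.
rewrite big_cons big_seq1/= eqxx eq_sym (negbTE ne).
by rewrite (expectation_density f1 (ma m) (aC m))
  (expectation_density f2 (mb m) (bC m)).
Qed.

(** Only this second moment of the product of the estimators enters the risk. In
    each factor the N pairs of equal indices give the moment of [a * b] and the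
    N (N - 1) other pairs give a product of means. *)
Lemma expectation_prod_sums :
  (\int[P]_w (\prod_m ((\sum_(i < N m) a m (X m i w)) *
                       (\sum_(i < N m) b m (X m i w))))%:E =
  (\prod_m ((N m)%:R * Ep m (fun u => a m u * b m u) +
    (N m)%:R * ((N m)%:R - 1) * (Ep m (a m) * Ep m (b m))))%:E)%E.
Proof.
(* Summing over the fixed range B, with zero terms beyond the size of each
   sample, makes all the index sets equal, so the product of the sums
   distributes into a sum over functions. *)
pose B := \max_m N m.
have NB m : (N m <= B)%N by exact: (leq_bigmax m).
pose V m (j : 'I_B * 'I_B) := ((j.1 < N m)%N && (j.2 < N m)%N).
pose F w m (j : 'I_B * 'I_B) : R :=
  if V m j then a m (X m j.1 w) * b m (X m j.2 w) else 0.
pose e m (j : 'I_B * 'I_B) : R := if V m j then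
  (if j.1 == j.2 then Ep m (fun u => a m u * b m u) else Ep m (a m) * Ep m (b m))
  else 0.
have sumB m (G : nat -> R) : \sum_(i < N m) G i = \sum_(i < B | (i < N m)%N) G i.
  by rewrite (big_ord_widen _ G (NB m)).
have FE w m : (\sum_(i < N m) a m (X m i w)) * (\sum_(i < N m) b m (X m i w)) =
    \sum_j F w m j.
  rewrite (sumB m (fun i => a m (X m i w))) (sumB m (fun i => b m (X m i w))).
  rewrite mulr_suml (eq_bigr (fun i : 'I_B => \sum_(j < B | (j < N m)%N)
    (a m (X m i w) * b m (X m j w)))); last by move=> i _; rewrite mulr_sumr.
  rewrite pair_big/= [LHS]big_mkcond/=; apply: eq_bigr => -[i j] _ //.
have eE m : (N m)%:R * Ep m (fun u => a m u * b m u) +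
    (N m)%:R * ((N m)%:R - 1) * (Ep m (a m) * Ep m (b m)) = \sum_j e m j.
  rewrite /e -big_mkcond/= /V.
  rewrite -(pair_big (fun i : 'I_B => (i < N m)%N) (fun j : 'I_B => (j < N m)%N)
    (fun i j => if i == j then Ep m (fun u => a m u * b m u)
      else Ep m (a m) * Ep m (b m)))/=.
  rewrite (eq_bigr (fun=> Ep m (fun u => a m u * b m u) +
    ((N m)%:R - 1) * (Ep m (a m) * Ep m (b m)))).
    rewrite -(sumB m (fun=> Ep m (fun u => a m u * b m u) +
      ((N m)%:R - 1) * (Ep m (a m) * Ep m (b m)))).
    by rewrite sumr_const card_ord -[RHS]mulr_natl; ring.
  move=> i iN; rewrite (bigD1 i)//= eqxx; congr (_ + _).
  rewrite (eq_bigr (fun=> Ep m (a m) * Ep m (b m))); last first.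
    by move=> j /andP[_ ji]; rewrite eq_sym (negbTE ji).
  have := sumB m (fun=> Ep m (a m) * Ep m (b m)).
  rewrite (bigD1 i)//= => h.
  move: h; rewrite [LHS]sumr_const card_ord => h.
  by rewrite mulrBl mul1r mulr_natl h addrAC subrr add0r.
under eq_integral => w _.
  rewrite (eq_bigr (fun m => \sum_j F w m j)) ?bigA_distr_bigA; last by [].
  rewrite -sumEFin; over.
rewrite (eq_bigr (fun m => \sum_j e m j)) ?bigA_distr_bigA; last by [].
have F0 w m j : 0 <= F w m j by rewrite /F; case: ifP => // _; rewrite mulr_ge0.
have mF m j : measurable_fun setT (fun w => F w m j).
  rewrite /F; case: (V m j) => //.
  by apply: measurable_funM; exact: measurableT_comp.
rewrite ge0_integral_sum//.
- rewrite -sumEFin; apply: eq_bigr => f _.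
  have [vf|/forallPn[m nvm]] := boolP [forall m, V m (f m)].
    have vm m : V m (f m) by exact: (forallP vf).
    transitivity (\int[P]_w (\prod_m
        (a m (X m (f m).1 w) * b m (X m (f m).2 w)))%:E)%E.
      by apply: eq_integral => w _; congr EFin; apply: eq_bigr => m _; rewrite /F vm.
    rewrite (@expectation_pairs (fun m => ((f m).1 : nat, (f m).2 : nat)) vm).
    by congr EFin; apply: eq_bigr => m _; rewrite /e vm.
  rewrite (bigD1 m)//= {1}/e (negbTE nvm) mul0r.
  rewrite integral0_eq// => w _.
  by rewrite (bigD1 m)//= {1}/F (negbTE nvm) mul0r.
- by move=> f; apply/measurable_EFinP; apply: measurable_prod => m _.
- by move=> f w _; rewrite lee_fin prodr_ge0.
Qed.

End SampleMoments.

(** * Sums and products of integrable functions *)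

Section ProductsOfFunctions.
Context (R : realType) (M : nat).
Local Notation mu := (@lebesgue_measure R).
Implicit Types (a g : 'I_M -> R).

Lemma size_index_ord : size (index_enum 'I_M) = M.
Proof. by rewrite -[RHS](card_ord M) cardT enumT. Qed.

Lemma norm_prod_cond_le (Q : pred 'I_M) a c : 1 <= c ->
  (forall i, `|a i| <= c) -> `|\prod_(i | Q i) a i| <= c ^+ M.
Proof.
move=> c1 ac; rewrite big_mkcond/= -[X in c ^+ X]size_index_ord.
apply: norm_prod_le => i; case: ifP => // _.
by rewrite normr1.
Qed.

Lemma prod_cond_diff1 (Q : pred 'I_M) a g c : 1 <= c ->
  (forall i, `|a i| <= c) -> (forall i, `|g i| <= c) ->
  `|\prod_(i | Q i) a i - \prod_(i | Q i) g i| <= c ^+ M * \sum_i `|a i - g i|.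
Proof.
move=> c1 ac gc; rewrite [X in `|X - _|]big_mkcond [X in `|_ - X|]big_mkcond/=.
have c0 : 0 <= c by apply: le_trans c1.
apply: le_trans (prod_diff1 _ c1 _ _) _.
- by move=> i; case: ifP => // _; rewrite normr1.
- by move=> i; case: ifP => // _; rewrite normr1.
rewrite size_index_ord ler_wpM2l ?exprn_ge0// ler_sum// => i _.
by case: ifP => // _; rewrite subrr normr0.
Qed.

Lemma prod_ord_diff1 a g c : 1 <= c ->
  (forall i, `|a i| <= c) -> (forall i, `|g i| <= c) ->
  `|\prod_i a i - \prod_i g i| <= c ^+ M * \sum_i `|a i - g i|.
Proof. exact: (prod_cond_diff1 xpredT). Qed.

Lemma prod_ord_diff2 a g c : 1 <= c ->
  (forall i, `|a i| <= c) -> (forall i, `|g i| <= c) ->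
  `|\prod_i a i - \prod_i g i
      - \sum_i (a i - g i) * \prod_(k | k != i) g k|
    <= c ^+ M * (\sum_i `|a i - g i|) ^+ 2.
Proof.
move=> c1 ac gc; rewrite -[X in c ^+ X]size_index_ord.
exact: (prod_diff2 (index_enum_uniq _)).
Qed.

Lemma measurable_prod_cond d (T : measurableType d) (Q : pred 'I_M)
    (g : 'I_M -> T -> R) : (forall m, measurable_fun setT (g m)) ->
  measurable_fun setT (fun x => \prod_(m | Q m) g m x).
Proof.
move=> mg; under eq_fun do rewrite big_mkcond/=.
apply: measurable_prod => m _; case: (Q m); [exact: mg | exact: measurable_cst].
Qed.

Lemma integral_le_sum_norm d (T : measurableType d)
    (m : {measure set T -> \bar R}) (s : 'I_M -> T -> R) (g : T -> R) c B :
  (forall i, measurable_fun setT (s i)) -> measurable_fun setT g -> 0 <= c ->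
  (forall x, `|g x| <= c * \sum_i `|s i x|) ->
  (forall i, \int[m]_x `|s i x|%:E <= B%:E)%E ->
  (\int[m]_x `|g x|%:E <= (c * (M%:R * B))%:E)%E.
Proof.
move=> ms mg c0 gs sB.
have ns i : measurable_fun setT (fun x => `|s i x|).
  by apply: measurableT_comp => //; exact: ms.
have nsE i : measurable_fun setT (fun x => `|s i x|%:E).
  exact/measurable_EFinP.
have mS : measurable_fun setT (fun x => \sum_i `|s i x|).
  exact: measurable_sum.
apply: (@le_trans _ _ (\int[m]_x (c * \sum_i `|s i x|)%:E)%E).
  apply: ge0_le_integral => //.
  - by apply/measurable_EFinP; exact: measurableT_comp.
  - by apply/measurable_EFinP; exact: measurable_funM.
  - by move=> x _; rewrite lee_fin.
under eq_integral do rewrite EFinM.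
rewrite ge0_integralZl//; last 2 first.
- exact/measurable_EFinP.
- by move=> x _; rewrite lee_fin sumr_ge0.
rewrite EFinM lee_wpmul2l//.
under eq_integral do rewrite -sumEFin.
rewrite ge0_integral_sum//.
apply: (@le_trans _ _ (\sum_(i < M) B%:E)%E).
  by apply: lee_sum => i _; exact: sB.
by rewrite sumEFin sumr_const card_ord mulr_natl.
Qed.

Lemma l1sup_prod_fun (g : 'I_M -> R -> R) c : (0 < M)%N ->
  (forall m, l1sup mu (g m) c) -> l1sup mu (fun x => \prod_m g m x) (c ^+ M).
Proof.
move=> M0 gc; rewrite -[X in c ^+ X]size_index_ord.
by apply: (@l1sup_prod _ _ _ _ _ (Ordinal M0)) => //; exact: mem_index_enum.
Qed.

Lemma l1sup_sum_ord (F : 'I_M -> R -> R) c : (forall m, l1sup mu (F m) c) ->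
  l1sup mu (fun x => \sum_m F m x) (M%:R * c).
Proof.
move=> Fc; have := l1sup_sum (index_enum 'I_M) Fc.
by rewrite sumr_const card_ord mulr_natl.
Qed.

Lemma l1sup_eq (f g : R -> R) (a b : R) : l1sup mu f a -> f =1 g -> a <= b ->
  l1sup mu g b.
Proof. by move=> fa /funext <- ab; exact: le_l1sup fa. Qed.

End ProductsOfFunctions.

(** * The centred quadratic form *)
Section QuadraticForm.
Context (R : realType).
Local Notation mu := (@lebesgue_measure R).
Variables (pi : R -> R) (cpi : R).
Hypothesis pi_c : l1sup mu pi cpi.

(** The risk is the integral of the square of [center] of the product of the
    estimators; [center] is linear and vanishes on multiples of [pi] when [pi]
    has mass 1. *)
Definition center (g : R -> R) (x : R) : R := g x - (\int[mu]_y g y) * pi x.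

Lemma l1sup_center g a : l1sup mu g a -> l1sup mu (center g) (a * (1 + cpi)).
Proof.
move=> ga; have c0 := l1sup_ge0 pi_c.
rewrite mulrDr mulr1; apply: (l1supB ga).
apply: (le_l1sup _ (l1supZ _ pi_c)); apply: ler_wpM2r => //.
exact: l1sup_Rintegral ga.
Qed.

Lemma integral_center_sq g a : l1sup mu g a ->
  \int[mu]_x (center g x ^+ 2) = \int[mu]_x (g x ^+ 2)
    - 2 * ((\int[mu]_x g x) * \int[mu]_x (pi x * g x))
    + (\int[mu]_x g x) ^+ 2 * \int[mu]_x (pi x ^+ 2).
Proof.
move=> ga; set I := \int[mu]_x g x.
have i1 := l1sup_integrable (l1supM ga ga).
have i2 := l1sup_integrable (l1supZ (2 * I) (l1supM pi_c ga)).
have i2' := l1sup_integrable (l1supM pi_c ga).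
have i3 := l1sup_integrable (l1supZ (I ^+ 2) (l1supM pi_c pi_c)).
have i3' := l1sup_integrable (l1supM pi_c pi_c).
have i12 := l1sup_integrable (l1supB (l1supM ga ga) (l1supZ (2 * I) (l1supM pi_c ga))).
transitivity (\int[mu]_x (g x * g x - 2 * I * (pi x * g x)
    + I ^+ 2 * (pi x * pi x))).
  by apply: eq_Rintegral => x _; rewrite /center -/I; ring.
by rewrite RintegralD// RintegralB// !RintegralZl// mulrA.
Qed.

Lemma integral_sq_diff f g a b c : l1sup mu f a -> l1sup mu g b ->
  l1sup mu (fun x => f x - g x) c ->
  `|\int[mu]_x (f x ^+ 2) - \int[mu]_x (g x ^+ 2)| <= c * (a + b).
Proof.
move=> fa gb fgc.
have i1 := l1sup_integrable (l1supM fa fa).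
have i2 := l1sup_integrable (l1supM gb gb).
have -> : \int[mu]_x (f x ^+ 2) - \int[mu]_x (g x ^+ 2) =
    \int[mu]_x ((f x - g x) * (f x + g x)).
  transitivity (\int[mu]_x (f x * f x) - \int[mu]_x (g x * g x)).
    by congr (_ - _); apply: eq_Rintegral => x _; rewrite expr2.
  by rewrite -RintegralB//; apply: eq_Rintegral => x _ /=; ring.
exact: (l1sup_Rintegral (l1supM fgc (l1supD fa gb))).
Qed.

Lemma centerB f g a b : l1sup mu f a -> l1sup mu g b ->
  forall x, center (fun x => f x - g x) x = center f x - center g x.
Proof.
move=> fa gb x; rewrite /center RintegralB//.
- by ring.
- exact: l1sup_integrable fa.
- exact: l1sup_integrable gb.
Qed.

End QuadraticForm.

(** * Expansion of the second moment of the product *)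

Section MomentExpansion.
Context (R : realType) (M : nat) (M0 : (0 < M)%N).
Local Notation mu := (@lebesgue_measure R).
Variables (p p2 : 'I_M -> R -> R) (k kappa b : R) (pi : R -> R) (cpi : R).
Hypotheses (b1 : 1 <= b) (kb : `|k| <= b) (kappab : `|kappa| <= b).
Hypotheses (pb : forall m, l1sup mu (p m) b)
  (p2b : forall m, l1sup mu (p2 m) b).
Hypotheses (pi_c : l1sup mu pi cpi)
  (piE : forall x, prod_fun p x = prod_mass p * pi x).
Variables (H eta : R) (h e : 'I_M -> R) (f : 'I_M -> R -> R)
  (r : 'I_M -> R * R -> R).
(* h are the bandwidths and e the inverse effective sample sizes 1 / (N h); f and
   r are the means and covariances of the estimators. *)
Hypotheses (H0 : 0 <= H) (H1 : H <= 1) (eta0 : 0 <= eta) (eta1 : eta <= 1).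
Hypotheses (hH : forall m, 0 <= h m <= H) (e_eta : forall m, 0 <= e m <= eta).
Hypotheses (fb : forall m, l1sup mu (f m) b)
  (f_bias : forall m, l1sup mu
     (fun x => f m x - (p m x + h m ^+ 2 * k * p2 m x)) (b * H ^+ 3)).
Hypotheses (mr : forall m, measurable_fun setT (r m))
  (r_sup : forall m z, `|r m z| <= b * eta)
  (r_int : forall m,
     (\int[(mu \x mu)%E]_z `|r m z|%:E <= (b * H * eta)%:E)%E)
  (r_diag : forall m, l1sup mu (fun x => r m (x, x) - e m * kappa * p m x)
     (b * H * eta)).

Let b0 : 0 <= b. Proof. exact: le_trans b1. Qed.
Let bM0 n : 0 <= b ^+ n. Proof. exact: exprn_ge0. Qed.
Let m0 : 0 <= M%:R :> R. Proof. by []. Qed.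
Let p_sup m x : `|p m x| <= b. Proof. by case: (pb m). Qed.
Let f_sup m x : `|f m x| <= b. Proof. by case: (fb m). Qed.
Let mp m : measurable_fun setT (p m). Proof. by case: (pb m). Qed.
Let mf m : measurable_fun setT (f m). Proof. by case: (fb m). Qed.
Let mp2 m : measurable_fun setT (p2 m). Proof. by case: (p2b m). Qed.

(** The bias and the variance of the product of the estimators to first order,
    without their normalising constants. *)
Definition first_order (x : R) : R :=
  k * \sum_m h m ^+ 2 * p2 m x * \prod_(j | j != m) p j x.
Definition first_variance (x : R) : R :=
  \sum_m p m x * e m * \prod_(j | j != m) p j x ^+ 2.
Definition cross_moment (z : R * R) : R := \prod_m (f m z.1 * f m z.2 + r m z).

Let F x := \prod_m f m x.

Let h2 m : 0 <= h m ^+ 2 <= H ^+ 2.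
Proof. by have /andP[h0 h1] := hH m; rewrite exprn_ge0//= lerXn2r// nnegrE. Qed.

Let l1sup_u m : l1sup mu (fun x => f m x - p m x) (2 * b ^+ 2 * H ^+ 2).
Proof.
apply: (l1sup_eq (l1supD (f_bias m) (l1supZ (h m ^+ 2 * k) (p2b m)))).
  by move=> x /=; ring.
have /andP[h20 h2H] := h2 m.
rewrite normrM (ger0_norm h20).
have H3 : b * H ^+ 3 <= b ^+ 2 * H ^+ 2.
  apply: (@le_trans _ _ (b * H ^+ 2)).
    by rewrite ler_wpM2l// exprS ler_piMl// exprn_ge0.
  by rewrite ler_wpM2r ?exprn_ge0// expr2 ler_peMl.
have : h m ^+ 2 * `|k| * b <= b ^+ 2 * H ^+ 2.
  by rewrite expr2 -mulrA mulrC ler_pM// ?mulr_ge0// ler_wpM2r.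
move: H3; set x := b ^+ 2 * H ^+ 2 => *.
have -> : 2 * b ^+ 2 * H ^+ 2 = x + x by rewrite /x; ring.
exact: lerD.
Qed.

(* c_rho collects the quadratic remainder of the product expansion and the
   Taylor remainders of the factors. *)
Let c_rho : R := b ^+ M * (M%:R * (2 * b ^+ 2)) ^+ 2 + M%:R * (b ^+ M * b).
Let c_D : R := b * (M%:R * (b ^+ M * b)).

(** The product of the smoothed densities has two errors beyond the first order:
    the quadratic terms of the product ([g1], of order H^4) and the cubic biases
    of the factors ([g2], of order H^3). *)
Let l1sup_rho :
  l1sup mu (fun x => F x - prod_fun p x - first_order x) (c_rho * H ^+ 3).
Proof.
pose g1 x := F x - prod_fun p x
  - \sum_m (f m x - p m x) * \prod_(j | j != m) p j x.
pose g2 x := \sum_m \prod_(j | j != m) p j x *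
  (f m x - (p m x + h m ^+ 2 * k * p2 m x)).
have mg1 : measurable_fun setT g1.
  apply: measurable_funB; first apply: measurable_funB.
  - by apply: measurable_prod => m _; exact: mf.
  - by apply: measurable_prod => m _; exact: mp.
  - apply: measurable_sum => m; apply: measurable_funM.
      exact: measurable_funB.
    exact: measurable_prod_cond.
have S1 : l1sup mu (fun x => \sum_m `|f m x - p m x|)
    (M%:R * (2 * b ^+ 2 * H ^+ 2)).
  by apply: l1sup_sum_ord => m; exact: l1sup_norm.
have g1S x : `|g1 x| <= `|b ^+ M * ((\sum_m `|f m x - p m x|) *
    \sum_m `|f m x - p m x|)|.
  rewrite [leRHS]ger0_norm; last by rewrite !mulr_ge0// sumr_ge0.
  by rewrite -expr2; exact: prod_ord_diff2.
have L1 : l1sup mu g1 (b ^+ M * (M%:R * (2 * b ^+ 2)) ^+ 2 * H ^+ 3).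
  apply: (le_l1sup _ (@l1sup_dominated _ _ _ mu _ _ _ mg1 g1S
    (l1supZ (b ^+ M) (l1supM S1 S1)))).
  rewrite ger0_norm//.
  have -> : b ^+ M * (M%:R * (2 * b ^+ 2 * H ^+ 2) * (M%:R * (2 * b ^+ 2 * H ^+ 2)))
    = b ^+ M * (M%:R * (2 * b ^+ 2)) ^+ 2 * (H ^+ 3 * H) by ring.
  rewrite ler_wpM2l ?mulr_ge0 ?exprn_ge0 ?mulr_ge0//.
  by rewrite ler_piMr ?exprn_ge0.
have L2 : l1sup mu g2 (M%:R * (b ^+ M * b) * H ^+ 3).
  have -> : M%:R * (b ^+ M * b) * H ^+ 3 = M%:R * (b ^+ M * (b * H ^+ 3)) by ring.
  apply: l1sup_sum_ord => m; apply: l1supM_bounded => //.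
    exact: measurable_prod_cond.
  by move=> x; apply: norm_prod_cond_le => // j; exact: p_sup.
apply: (l1sup_eq (l1supD L1 L2)); last by rewrite -mulrDl.
move=> x /=; rewrite /g1 /g2 /first_order mulr_sumr.
have -> : \sum_m \prod_(j | j != m) p j x *
      (f m x - (p m x + h m ^+ 2 * k * p2 m x)) =
    \sum_m (f m x - p m x) * \prod_(j | j != m) p j x -
    \sum_m k * (h m ^+ 2 * p2 m x * \prod_(j | j != m) p j x).
  by rewrite -sumrB; apply: eq_bigr => m _; ring.
by ring.
Qed.


Lemma l1sup_first_order : l1sup mu first_order (c_D * H ^+ 2).
Proof.
have -> : c_D * H ^+ 2 = b * (M%:R * (b ^+ M * (H ^+ 2 * b))) by rewrite /c_D; ring.
have S : l1sup mu (fun x => \sum_m h m ^+ 2 * p2 m x * \prod_(j | j != m) p j x)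
    (M%:R * (b ^+ M * (H ^+ 2 * b))).
  apply: l1sup_sum_ord => m.
  apply: (@l1sup_eq _ (fun x => \prod_(j | j != m) p j x * (h m ^+ 2 * p2 m x))
    _ (b ^+ M * (H ^+ 2 * b))) => //; last by move=> x; rewrite mulrC.
  apply: l1supM_bounded => //.
  - exact: measurable_prod_cond.
  - by move=> x; apply: norm_prod_cond_le => // j; exact: p_sup.
  - have /andP[h20 h2H] := h2 m.
    apply: (le_l1sup _ (l1supZ (h m ^+ 2) (p2b m))).
    by rewrite ger0_norm// ler_wpM2r.
apply: (le_l1sup _ (l1supZ k S)).
by rewrite ler_wpM2r// !mulr_ge0// exprn_ge0.
Qed.

Let l1sup_F : l1sup mu F (b ^+ M). Proof. exact: l1sup_prod_fun. Qed.
Let l1sup_P : l1sup mu (prod_fun p) (b ^+ M).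
Proof. exact: (l1sup_prod_fun M0 pb). Qed.

Let c_bias : R := c_rho * (1 + cpi) * ((c_rho + c_D) * (1 + cpi) + c_D * (1 + cpi)).

Let c_rho0 : 0 <= c_rho.
Proof. by rewrite addr_ge0// ?mulr_ge0// ?exprn_ge0// ?mulr_ge0. Qed.

(** [center] kills [prod_fun p], so it only sees F - prod_fun p, which is of
    order H^2 and differs from [first_order] by H^3; the difference of the
    squares is thus of order H^2 H^3. *)
Lemma bias_expansion :
  `|\int[mu]_x (center pi F x ^+ 2) - \int[mu]_x (center pi first_order x ^+ 2)|
    <= c_bias * H ^+ 5.
Proof.
pose beta x := F x - prod_fun p x.
have L : l1sup mu beta ((c_rho + c_D) * H ^+ 2).
  apply: (l1sup_eq (l1supD l1sup_rho l1sup_first_order)); first by move=> x /=; rewrite subrK.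
  rewrite [leRHS]mulrDl; apply: lerD => //; apply: ler_wpM2l => //.
  by rewrite exprS ler_piMl// exprn_ge0.
have cF x : center pi F x = center pi beta x.
  rewrite (centerB _ l1sup_F l1sup_P) /center piE.
  by rewrite -/(prod_mass p) subrr subr0.
under eq_Rintegral => x _ do rewrite cF.
have cL := l1sup_center pi_c L; have cD := l1sup_center pi_c l1sup_first_order.
have cR := l1sup_center pi_c l1sup_rho.
apply: le_trans (integral_sq_diff cL cD _) _.
  by apply: (l1sup_eq cR) => // x; rewrite -(centerB _ L l1sup_first_order).
rewrite le_eqVlt; apply/orP; left; apply/eqP; rewrite /c_bias; ring.
Qed.

(* A common bound of the factors of the cross moment and of their leading
   parts. *)
Let c : R := 2 * b ^+ 2.
Let c1 : 1 <= c.
Proof. rewrite /c; have := exprn_ege1 2 b1; lra. Qed.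
Let c0 : 0 <= c. Proof. exact: le_trans c1. Qed.
Let b2c : b ^+ 2 <= c.
Proof. rewrite /c; have := exprn_ge0 2 b0; lra. Qed.
Let ff_sup m x y : `|f m x * f m y| <= b ^+ 2.
Proof. by rewrite normrM expr2 ler_pM. Qed.
Let ffr_sup m z : `|f m z.1 * f m z.2 + r m z| <= c.
Proof.
apply: le_trans (ler_normD _ _) _.
have -> : c = b ^+ 2 + b ^+ 2 by rewrite /c; ring.
apply: lerD => //; apply: le_trans (r_sup m z) _.
by rewrite expr2 ler_wpM2l//; exact: le_trans b1.
Qed.
Let ff_sup' m x y : `|f m x * f m y| <= c. Proof. exact: le_trans b2c. Qed.

Let mff m : measurable_fun setT (fun z : R * R => f m z.1 * f m z.2).
Proof. by apply: measurable_funM; exact: measurableT_comp. Qed.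

Lemma measurable_cross_moment : measurable_fun setT cross_moment.
Proof. by apply: measurable_prod => m _; exact: measurable_funD. Qed.

Let FF z := F z.1 * F z.2.
Let mFF : measurable_fun setT FF.
Proof.
by apply: measurable_funM; apply: measurableT_comp => //; case: l1sup_F.
Qed.

Let c_off : R := c ^+ M * (M%:R * b).

(** Against a bounded weight only the L1 norms of the covariances [r] matter, and
    these are smaller than their uniform norms by a factor H. *)
Lemma cross_moment_expansion (w : R * R -> R) W : measurable_fun setT w ->
  (forall z, `|w z| <= W) ->
  (mu \x mu)%E.-integrable setT
    (EFin \o (fun z => w z * (cross_moment z - FF z))) /\
  `|\int[(mu \x mu)%E]_z (w z * (cross_moment z - FF z))|
    <= W * c_off * (H * eta).
Proof.
move=> mw wW.
have W0 : 0 <= W by apply: le_trans (wW (0, 0)).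
have mU : measurable_fun setT (fun z => w z * (cross_moment z - FF z)).
  apply: measurable_funM => //; apply: measurable_funB => //.
  exact: measurable_cross_moment.
have I : (\int[(mu \x mu)%E]_z `|w z * (cross_moment z - FF z)|%:E <=
    (W * c_off * (H * eta))%:E)%E.
  have -> : W * c_off * (H * eta) = W * c ^+ M * (M%:R * (b * H * eta)).
    by rewrite /c_off; ring.
  apply: (@integral_le_sum_norm _ _ _ _ (mu \x mu)%E r _ (W * c ^+ M)) => //.
    by rewrite mulr_ge0// exprn_ge0.
  move=> z; rewrite normrM -mulrA ler_pM//.
  rewrite /FF -big_split/=.
  apply: le_trans (prod_ord_diff1 c1 (ffr_sup^~ z) (fun i => ff_sup' i z.1 z.2)) _.
  by rewrite ler_wpM2l ?exprn_ge0// ler_sum// => m _; rewrite addrAC subrr add0r.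
have iU : (mu \x mu)%E.-integrable setT
    (EFin \o (fun z => w z * (cross_moment z - FF z))).
  apply/integrableP; split; first exact/measurable_EFinP.
  exact: le_lt_trans I (ltry _).
split=> //; rewrite -lee_fin EFin_normr_Rintegral//.
by apply: le_trans I; apply: le_abse_integral => //; exact/measurable_EFinP.
Qed.


Let c_var : R := c ^+ M * (M%:R * (2 * b ^+ 2)) ^+ 2 + M%:R * (c ^+ M * b) +
  M%:R * (c ^+ M * (M%:R * (4 * b ^+ 3)) * b ^+ 2).

Let cM0 : 0 <= c ^+ M. Proof. exact: exprn_ge0. Qed.

Let e_kappa_p m : l1sup mu (fun x => e m * kappa * p m x) (b ^+ 2 * eta).
Proof.
have /andP[e0 e1] := e_eta m.
apply: (le_l1sup _ (l1supZ _ (pb m))).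
rewrite normrM (ger0_norm e0).
have -> : b ^+ 2 * eta = eta * b * b by ring.
by rewrite ler_wpM2r// ler_pM.
Qed.

Let l1sup_rd m : l1sup mu (fun x => r m (x, x)) (2 * b ^+ 2 * eta).
Proof.
apply: (l1sup_eq (l1supD (r_diag m) (e_kappa_p m))).
  by move=> x /=; rewrite subrK.
have -> : 2 * b ^+ 2 * eta = b * b * eta + b ^+ 2 * eta by ring.
rewrite lerD// ler_wpM2r// ler_wpM2l//; exact: le_trans b1.
Qed.

Let mrd m : measurable_fun setT (fun x => r m (x, x)).
Proof. by case: (l1sup_rd m). Qed.

Let pp_sup m x : `|p m x ^+ 2| <= c.
Proof. by apply: le_trans b2c; rewrite normrX lerXn2r// nnegrE. Qed.

(** On the diagonal the covariances are as large as [eta], so the first-order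
    term of the product survives. The three errors are the quadratic remainder
    in [r] ([g1]), the error of [r] itself ([g2]), and the replacement of the
    smoothed densities by the densities in the cofactors ([g3]). *)
Lemma variance_expansion :
  l1sup mu (fun x => cross_moment (x, x) - F x ^+ 2 - kappa * first_variance x)
    (c_var * (H * eta + eta ^+ 2)).
Proof.
pose fp m x := f m x * f m x.
pose g1 x := cross_moment (x, x) - \prod_m fp m x
  - \sum_m (f m x * f m x + r m (x, x) - fp m x) * \prod_(j | j != m) fp j x.
pose g2 x := \sum_m \prod_(j | j != m) fp j x *
   (r m (x, x) - e m * kappa * p m x).
pose g3 x := \sum_m (\prod_(j | j != m) fp j x - \prod_(j | j != m) p j x ^+ 2)
   * (e m * kappa * p m x).
have mfp m : measurable_fun setT (fp m) by exact: measurable_funM.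
have mpp m : measurable_fun setT (fun x => p m x ^+ 2) by exact: measurable_funX.
have S1 : l1sup mu (fun x => \sum_m `|r m (x, x)|) (M%:R * (2 * b ^+ 2 * eta)).
  by apply: l1sup_sum_ord => m; exact: l1sup_norm.
have mg1 : measurable_fun setT g1.
  apply: measurable_funB; first apply: measurable_funB.
  - by apply: measurable_prod => m _; apply: measurable_funD; [exact: mfp|exact: mrd].
  - by apply: measurable_prod => m _; exact: mfp.
  - apply: measurable_sum => m; apply: measurable_funM.
      apply: measurable_funB; last exact: mfp.
      by apply: measurable_funD; [exact: mfp|exact: mrd].
    exact: measurable_prod_cond.
have g1S x : `|g1 x| <= `|c ^+ M * ((\sum_m `|r m (x, x)|) *
    \sum_m `|r m (x, x)|)|.
  rewrite [leRHS]ger0_norm; last by rewrite !mulr_ge0// sumr_ge0.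
  have := @prod_ord_diff2 _ _ (fun m => f m x * f m x + r m (x, x))
    (fun m => fp m x) c c1 (ffr_sup^~ (x, x)) (fun m => ff_sup' m x x).
  rewrite -expr2; congr (_ <= _ * _ ^+ 2).
  by apply: eq_bigr => m _; rewrite addrAC subrr add0r.
have L1 : l1sup mu g1 (c ^+ M * (M%:R * (2 * b ^+ 2)) ^+ 2 * eta ^+ 2).
  apply: (le_l1sup _ (@l1sup_dominated _ _ _ mu _ _ _ mg1 g1S
    (l1supZ (c ^+ M) (l1supM S1 S1)))).
  rewrite ger0_norm// le_eqVlt; apply/orP; left; apply/eqP; ring.
have L2 : l1sup mu g2 (M%:R * (c ^+ M * b) * (H * eta)).
  have -> : M%:R * (c ^+ M * b) * (H * eta) = M%:R * (c ^+ M * (b * H * eta)).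
    by ring.
  apply: l1sup_sum_ord => m; apply: l1supM_bounded => //.
    exact: measurable_prod_cond.
  by move=> x; apply: norm_prod_cond_le => // j; exact: ff_sup'.
have L3 : l1sup mu g3
    (M%:R * (c ^+ M * (M%:R * (4 * b ^+ 3)) * b ^+ 2) * (H * eta)).
  have -> : M%:R * (c ^+ M * (M%:R * (4 * b ^+ 3)) * b ^+ 2) * (H * eta) =
    M%:R * (c ^+ M * (M%:R * (4 * b ^+ 3) * H) * (b ^+ 2 * eta)) by ring.
  apply: l1sup_sum_ord => m; apply: l1supM_bounded (e_kappa_p m).
  - by apply: measurable_funB; exact: measurable_prod_cond.
  - by rewrite !mulr_ge0// exprn_ge0.
  - move=> x; apply: le_trans (prod_cond_diff1 _ c1 (fun j => ff_sup' j x x)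
      (pp_sup^~ x)) _.
    rewrite ler_wpM2l//.
    apply: (@le_trans _ _ (\sum_(j < M) 4 * b ^+ 3 * H)); last first.
      by rewrite sumr_const card_ord -[leLHS]mulr_natl mulrA.
    apply: ler_sum => j _.
    have -> : f j x * f j x - p j x ^+ 2 = (f j x - p j x) * (f j x + p j x).
      by ring.
    have -> : 4 * b ^+ 3 * H = (2 * b ^+ 2 * H) * (b + b) by ring.
    rewrite normrM ler_pM//; last first.
      by apply: le_trans (ler_normD _ _) _; rewrite lerD.
    have [_ uj _] := l1sup_u j; apply: le_trans (uj x) _.
    by rewrite ler_wpM2l ?mulr_ge0 ?exprn_ge0// expr2 ler_piMl.
apply: (l1sup_eq (l1supD L1 (l1supD L2 L3))).
  move=> x /=; rewrite /g1 /g2 /g3 /first_variance.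
  have -> : F x ^+ 2 = \prod_m fp m x by rewrite expr2 -big_split.
  have -> : \sum_m (f m x * f m x + r m (x, x) - fp m x) *
      \prod_(j | j != m) fp j x =
    \sum_m \prod_(j | j != m) fp j x * (r m (x, x) - e m * kappa * p m x) +
    \sum_m \prod_(j | j != m) fp j x * (e m * kappa * p m x).
    by rewrite -big_split; apply: eq_bigr => m _; rewrite /fp /=; ring.
  have -> : \sum_m (\prod_(j | j != m) fp j x -
      \prod_(j | j != m) p j x ^+ 2) * (e m * kappa * p m x) =
    \sum_m \prod_(j | j != m) fp j x * (e m * kappa * p m x) -
    kappa * \sum_m p m x * e m * \prod_(j | j != m) p j x ^+ 2.
    rewrite mulr_sumr -sumrB; apply: eq_bigr => m _.
    by ring.
  by ring.
have He : 0 <= H * eta by exact: mulr_ge0.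
have e2 : 0 <= eta ^+ 2 by exact: exprn_ge0.
have k1 : 0 <= c ^+ M * (M%:R * (2 * b ^+ 2)) ^+ 2.
  by rewrite !mulr_ge0// exprn_ge0// !mulr_ge0.
have k2 : 0 <= M%:R * (c ^+ M * b) by rewrite !mulr_ge0.
have k3 : 0 <= M%:R * (c ^+ M * (M%:R * (4 * b ^+ 3)) * b ^+ 2).
  by rewrite !mulr_ge0// exprn_ge0.
rewrite /c_var; move: k1 k2 k3; set x := c ^+ M * _ ^+ 2; set y := M%:R * (_ * b).
set z := M%:R * _ => k1 k2 k3.
have := mulr_ge0 k1 He; have := mulr_ge0 k2 e2; have := mulr_ge0 k3 e2.
rewrite !mulrDl !mulrDr; lra.
Qed.

Lemma l1sup_first_variance : l1sup mu first_variance (M%:R * (c ^+ M * b)).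
Proof.
apply: l1sup_sum_ord => m.
have /andP[e0 e1] := e_eta m.
apply: (@l1sup_eq _ (fun x => (e m * \prod_(j | j != m) p j x ^+ 2) * p m x)
  _ (c ^+ M * b)) => //; last by move=> x; ring.
apply: l1supM_bounded => //.
- apply: measurable_funM => //; apply: measurable_prod_cond => j.
  exact: (measurable_funX _ (mp j)).
- move=> x; rewrite normrM (ger0_norm e0) -[leRHS]mul1r ler_pM//.
    exact: (le_trans e1 eta1).
  by apply: norm_prod_cond_le => // j; exact: pp_sup.
Qed.

Definition c_expansion : R :=
  c_bias + c_var + 2 * (cpi * c_off) + cpi ^+ 2 * c_off.

Lemma second_moment_expansion :
  `|\int[mu]_x cross_moment (x, x)
    - 2 * \int[(mu \x mu)%E]_z (pi z.1 * cross_moment z)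
    + (\int[mu]_x pi x ^+ 2) * \int[(mu \x mu)%E]_z cross_moment z
    - (\int[mu]_x (center pi first_order x ^+ 2)
       + kappa * \int[mu]_x first_variance x)|
  <= c_expansion * (H ^+ 5 + H * eta + eta ^+ 2).
Proof.
have [mpi pi_s _] := pi_c; have cpi0 := l1sup_ge0 pi_c.
have mpi1 : measurable_fun setT (fun z : R * R => pi z.1).
  exact: measurableT_comp.
have pi_s1 (z : R * R) : `|pi z.1| <= cpi by [].
have [i1 e1] := cross_moment_expansion mpi1 pi_s1.
have one1 (z : R * R) : `|(fun=> 1) z : R| <= 1 by rewrite normr1.
have [i2 e2] := cross_moment_expansion
  (@measurable_cst _ _ (R * R)%type R setT 1) one1.
have [t1 T1] := l1sup_tensor (l1supM pi_c l1sup_F) l1sup_F.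
have [t2 T2] := l1sup_tensor l1sup_F l1sup_F.
have V := variance_expansion; have V' := l1sup_Rintegral V.
have E0 : \int[mu]_x cross_moment (x, x) = \int[mu]_x (F x ^+ 2)
    + kappa * \int[mu]_x first_variance x
    + \int[mu]_x (cross_moment (x, x) - F x ^+ 2 - kappa * first_variance x).
  have j1 := l1sup_integrable (l1supM l1sup_F l1sup_F).
  have j2 := l1sup_integrable (l1supZ kappa l1sup_first_variance).
  have j2' := l1sup_integrable l1sup_first_variance.
  have j3 := l1sup_integrable V.
  have j12 := l1sup_integrable (l1supD (l1supM l1sup_F l1sup_F) (l1supZ kappa l1sup_first_variance)).
  transitivity (\int[mu]_x (F x * F x + kappa * first_variance x
     + (cross_moment (x, x) - F x ^+ 2 - kappa * first_variance x))).
    by apply: eq_Rintegral => x _; ring.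
  rewrite [LHS]RintegralD//. rewrite [X in X + _]RintegralD// RintegralZl//.
have E1 : \int[(mu \x mu)%E]_z (pi z.1 * cross_moment z) =
    (\int[mu]_x (pi x * F x)) * (\int[mu]_x F x)
    + \int[(mu \x mu)%E]_z (pi z.1 * (cross_moment z - FF z)).
  rewrite -T1 -RintegralD//; last exact: l1sup_integrable t1.
  by apply: eq_Rintegral => z _; rewrite /FF /=; ring.
have E2 : \int[(mu \x mu)%E]_z cross_moment z =
    (\int[mu]_x F x) * (\int[mu]_x F x)
    + \int[(mu \x mu)%E]_z (1 * (cross_moment z - FF z)).
  rewrite -T2 -RintegralD//; last exact: l1sup_integrable t2.
  by apply: eq_Rintegral => z _; rewrite /FF /=; ring.
have B := bias_expansion.
rewrite (integral_center_sq pi_c l1sup_F) in B.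
have S : `|\int[mu]_x pi x ^+ 2| <= cpi ^+ 2.
  exact: (l1sup_Rintegral (l1supM pi_c pi_c)).
rewrite E0 E1 E2; move: B V' e1 e2 S.
set x0 := \int[mu]_x (cross_moment (x, x) - _ - _).
set x1 := \int[(mu \x mu)%E]_z (pi z.1 * _).
set x2 := \int[(mu \x mu)%E]_z (1 * _).
set IF := \int[mu]_x F x; set PF := \int[mu]_x (pi x * F x).
set A := \int[mu]_x (F x ^+ 2); set S := \int[mu]_x (pi x ^+ 2).
set D := \int[mu]_x (center _ _ _ ^+ 2); set V0 := \int[mu]_x first_variance x.
rewrite mul1r => B hx0 hx1 hx2 hS.
have -> : A + kappa * V0 + x0 - 2 * (PF * IF + x1) + S * (IF * IF + x2)
    - (D + kappa * V0) =
  (A - 2 * (IF * PF) + IF ^+ 2 * S - D) + x0 + (- (2 * x1)) + S * x2 by ring.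
apply: le_trans (ler_normD _ _) _; apply: le_trans (lerD (ler_normD _ _) (lexx _)) _.
apply: le_trans (lerD (lerD (ler_normD _ _) (lexx _)) (lexx _)) _.
rewrite normrN !normrM (ger0_norm (ler0n _ 2)).
have hSx2 : `|S| * `|x2| <= cpi ^+ 2 * c_off * (H * eta).
  by rewrite -mulrA ler_pM.
have He : 0 <= H * eta by exact: mulr_ge0.
have e20 : 0 <= eta ^+ 2 by exact: exprn_ge0.
have H50 : 0 <= H ^+ 5 by exact: exprn_ge0.
have coff0 : 0 <= c_off by rewrite !mulr_ge0.
have cbias0 : 0 <= c_bias.
  have cD0 : 0 <= c_D by rewrite !mulr_ge0.
  have cp1 : 0 <= 1 + cpi by rewrite addr_ge0.
  by rewrite !mulr_ge0// !addr_ge0// !mulr_ge0// addr_ge0.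
have cvar0 : 0 <= c_var.
  by rewrite !addr_ge0// !mulr_ge0// !exprn_ge0// !mulr_ge0.
rewrite /c_expansion; move: B hx0 hx1 hx2 hSx2 cbias0 cvar0 coff0.
move: c_bias c_var c_off => cb cv co B hx0 hx1 hx2 hSx2 cb0 cv0 co0.
have k1 : 0 <= cpi * co by exact: mulr_ge0.
have k2 : 0 <= cpi ^+ 2 * co by rewrite mulr_ge0// exprn_ge0.
have := mulr_ge0 cb0 He; have := mulr_ge0 cb0 e20; have := mulr_ge0 cv0 H50.
have := mulr_ge0 k1 H50; have := mulr_ge0 k2 H50.
have := mulr_ge0 k1 e20; have := mulr_ge0 k2 e20.
clear one1; lra.
Qed.

End MomentExpansion.

(** * Mean and covariance of a kernel density estimator *)

Section KernelDensity.
Context (R : realType).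
Local Notation mu := (@lebesgue_measure R).
Variables (K : R -> R) (C : R).
Hypotheses (hK : kde_kernel K) (KC : forall t, 0 <= K t <= C).

Let K0 t : 0 <= K t. Proof. by case/andP: (KC t). Qed.
Let KleC t : K t <= C. Proof. by case/andP: (KC t). Qed.
Let C0 : 0 <= C. Proof. exact: le_trans (K0 0) (KleC 0). Qed.
Let mK : measurable_fun setT K. Proof. by case: hK. Qed.
Let K1 : (\int[mu]_t (K t)%:E = 1)%E. Proof. by case: hK. Qed.

Let iK : mu.-integrable setT (EFin \o K).
Proof.
apply/integrableP; split; first exact/measurable_EFinP.
by under eq_integral do rewrite /= ger0_norm//; rewrite K1 ltry.
Qed.

Lemma Rintegral_kernel : \int[mu]_t K t = 1.
Proof. by rewrite /Rintegral K1. Qed.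

Lemma abs_moment2E : \int[mu]_t (t ^+ 2 * K t) = abs_moment K 2.
Proof. by apply: eq_Rintegral => t _; rewrite real_normK ?num_real. Qed.

Definition dilate (h u x : R) : R := K ((x - u) / h).

Variables (h : R) (h0 : 0 < h).
Let hn0 : h != 0. Proof. exact: lt0r_neq0. Qed.

Lemma measurable_dilate2 : measurable_fun setT (fun z : R * R => dilate h z.1 z.2).
Proof.
apply: measurableT_comp => //; apply: measurable_funM => //.
exact: measurable_funB.
Qed.

Lemma measurable_dilate u : measurable_fun setT (dilate h u).
Proof.
apply: measurableT_comp => //; apply: measurable_funM => //.
exact: measurable_funB.
Qed.

Lemma measurable_dilate_l x : measurable_fun setT (fun u => dilate h u x).
Proof.
apply: measurableT_comp => //; apply: measurable_funM => //.
exact: measurable_funB.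
Qed.

Lemma integral_dilate u : (\int[mu]_x (dilate h u x)%:E = h%:E)%E.
Proof.
have d0 x : 0 <= dilate h u x by exact: K0.
rewrite (ge0_integral_affine u hn0 (measurable_dilate u) d0).
under eq_integral => t _.
  rewrite /dilate (_ : (u + h * t - u) / h = t); last by field.
  rewrite EFinM; over.
rewrite ge0_integralZl//; last 2 first.
- exact/measurable_EFinP.
- by move=> x _; rewrite lee_fin.
by rewrite K1 mule1 gtr0_norm.
Qed.

Lemma l1sup_dilate u : l1sup mu (dilate h u) (C + h).
Proof.
split; first exact: measurable_dilate.
- by move=> x; rewrite ger0_norm ?K0// (le_trans (KleC _))// lerDl ltW.
- under eq_integral do rewrite ger0_norm ?K0//.
  by rewrite integral_dilate lee_fin lerDr.
Qed.

Variables (p : R -> R) (b : R).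
Hypotheses (hp : is_pdf p) (pb : l1sup mu p b).

Let p0 x : 0 <= p x. Proof. by case: hp. Qed.
Let mp : measurable_fun setT p. Proof. by case: hp. Qed.
Let ip : mu.-integrable setT (EFin \o p). Proof. exact: l1sup_integrable pb. Qed.
Let p1 : \int[mu]_u p u = 1. Proof. by rewrite /Rintegral; case: hp => _ _ ->. Qed.

Let substitution (w : R -> R) x : measurable_fun setT w -> (forall t, 0 <= w t) ->
  \int[mu]_u (p u * w ((x - u) / h)) = h * smooth w h p x.
Proof.
move=> mw w0; rewrite /Rintegral.
have nh0 : - h != 0 by rewrite oppr_eq0.
have mG : measurable_fun setT (fun u => p u * w ((x - u) / h)).
  apply: measurable_funM => //; apply: measurableT_comp => //.
  by apply: measurable_funM => //; exact: measurable_funB.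
have mS : measurable_fun setT (fun t => w t * p (x - h * t)).
  apply: measurable_funM => //; apply: measurableT_comp => //.
  by apply: measurable_funB => //; exact: measurable_funM.
have G0 u : 0 <= p u * w ((x - u) / h) by rewrite mulr_ge0.
rewrite (ge0_integral_affine x nh0 mG G0).
transitivity (fine (\int[mu]_t (h%:E * (w t * p (x - h * t))%:E)%E)).
  congr fine; apply: eq_integral => t _; rewrite -EFinM; congr EFin.
  rewrite (_ : (x - (x + - h * t)) / h = t); last by field.
  by rewrite normrN gtr0_norm// mulNr (mulrC (p _)).
rewrite ge0_integralZl//.
- rewrite /smooth /Rintegral.
  have [->|foo] := eqVneq (\int[mu]_t (w t * p (x - h * t))%:E)%E +oo%E.
    by rewrite gt0_muley ?lte_fin// mulr0.
  rewrite fineM// ge0_fin_numE ?lt_neqAle ?foo ?leey//.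
  by apply: integral_ge0 => t _; rewrite lee_fin mulr_ge0.
- exact/measurable_EFinP.
- by move=> t _; rewrite lee_fin mulr_ge0.
- by rewrite lee_fin ltW.
Qed.

Lemma integral_density_dilate x :
  \int[mu]_u (p u * dilate h u x) = h * smooth K h p x.
Proof. exact: substitution. Qed.

(** The mean of the product of the rescaled kernels centred at one sample point
    and evaluated at the two coordinates of [z]. *)
Definition overlap (z : R * R) : R :=
  (h ^+ 2)^-1 * \int[mu]_u (p u * (dilate h u z.1 * dilate h u z.2)).

Let mK2 : measurable_fun setT (fun t => K t ^+ 2).
Proof. exact: (measurable_funX _ mK). Qed.

Lemma overlap_diag x : overlap (x, x) = smooth (fun t => K t ^+ 2) h p x / h.
Proof.
rewrite /overlap/= (_ : \int[mu]_u _ = \int[mu]_u (p u * (K ((x - u) / h) ^+ 2))).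
  rewrite (@substitution (fun t => K t ^+ 2)) => [|//|t]; last by rewrite exprn_ge0.
  by field.
by apply: eq_Rintegral => u _; rewrite expr2.
Qed.

(* The integrand of overlap, as a function of the sample point and of the point
   of the plane, for Tonelli's theorem. *)
Let U (z : R * (R * R)) : R :=
  (h ^+ 2)^-1 * (p z.1 * (dilate h z.1 z.2.1 * dilate h z.1 z.2.2)).

Let mU : measurable_fun setT U.
Proof.
apply: measurable_funM => //; apply: measurable_funM; first exact: measurableT_comp.
apply: measurable_funM.
- apply: (@measurableT_comp _ _ _ _ _ _ (fun z : R * R => dilate h z.1 z.2) _
    (fun z : R * (R * R) => (z.1, z.2.1))); first exact: measurable_dilate2.
  by apply: measurable_fun_pair => //; exact: measurableT_comp.
- apply: (@measurableT_comp _ _ _ _ _ _ (fun z : R * R => dilate h z.1 z.2) _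
    (fun z : R * (R * R) => (z.1, z.2.2))); first exact: measurable_dilate2.
  by apply: measurable_fun_pair => //; exact: measurableT_comp.
Qed.


Let hh0 : 0 <= (h ^+ 2)^-1. Proof. by rewrite invr_ge0 exprn_ge0// ltW. Qed.

Lemma integrable_density (G : R -> R) B : measurable_fun setT G ->
  (forall x, 0 <= G x <= B) -> mu.-integrable setT (EFin \o (fun u => p u * G u)).
Proof.
move=> mG gB.
have pG : measurable_fun setT (fun u => p u * G u) by exact: measurable_funM.
apply: (@le_integrable _ _ _ mu setT measurableT _ (fun u => B%:E * (p u)%:E)%E).
- exact/measurable_EFinP.
- move=> u _; have /andP[G0 GB] := gB u.
  rewrite -EFinM lee_fin !normrM (mulrC `|B|) ler_wpM2l// ger0_norm//.
  exact: le_trans GB (ler_norm _).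
- exact: (integrableZl measurableT B ip).
Qed.

Let dd_bound x y u : 0 <= dilate h u x * dilate h u y <= C * C.
Proof. by rewrite mulr_ge0 ?K0//= ler_pM ?K0 ?KleC. Qed.

Let mdd x y : measurable_fun setT (fun u => dilate h u x * dilate h u y).
Proof. by apply: measurable_funM; exact: measurable_dilate_l. Qed.

Let overlapE z : overlap z = \int[mu]_u U (u, z).
Proof.
rewrite /overlap -RintegralZl//.
exact: (integrable_density (mdd z.1 z.2) (dd_bound z.1 z.2)).
Qed.

Lemma overlap_ge0 z : 0 <= overlap z.
Proof.
apply: mulr_ge0 => //; apply: Rintegral_ge0 => u _.
by rewrite !mulr_ge0// K0.
Qed.

(** One of the two kernels is bounded by its supremum, the other is integrated. *)
Lemma overlap_le z : overlap z <= C / h * smooth K h p z.1.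
Proof.
have -> : C / h * smooth K h p z.1 =
    (h ^+ 2)^-1 * (C * \int[mu]_u (p u * dilate h u z.1)).
  by rewrite integral_density_dilate; field.
rewrite /overlap ler_wpM2l//.
have dC u : 0 <= dilate h u z.1 <= C by rewrite K0 KleC.
have i1 := integrable_density (measurable_dilate_l z.1) dC.
rewrite -RintegralZl//; apply: le_Rintegral => //.
- exact: (integrable_density (mdd z.1 z.2) (dd_bound z.1 z.2)).
- exact: (integrableZl measurableT C i1).
- move=> u _; rewrite [leRHS]mulrCA ler_wpM2l// [leRHS]mulrC.
  by rewrite ler_wpM2l ?K0 ?KleC.
Qed.

Let l1sup_U u : l1sup (mu \x mu)%E (fun z => U (u, z))
  ((h ^+ 2)^-1 * p u * ((C + h) * (C + h))).
Proof.
have [T _] := l1sup_tensor (l1sup_dilate u) (l1sup_dilate u).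
have T' := l1supZ ((h ^+ 2)^-1 * p u) T.
rewrite ger0_norm in T'; last exact: mulr_ge0.
rewrite (_ : (fun z => U (u, z)) =
  (fun x => (h ^+ 2)^-1 * p u * (dilate h u x.1 * dilate h u x.2)))//.
apply/funext => z; by rewrite /U /=; ring.
Qed.

Let minkowski_U : [/\ (mu \x sf_product mu mu)%E.-integrable setT (EFin \o U),
      forall z, mu.-integrable setT (fun u => (U (u, z))%:E) &
      l1sup (mu \x mu)%E (fun z => \int[mu]_u U (u, z))
        ((h ^+ 2)^-1 * ((C + h) * (C + h)))].
Proof.
have T := @minkowski _ _ _ _ R mu (sf_product mu mu) U
  (fun u => (h ^+ 2)^-1 * p u * ((C + h) * (C + h)))
  ((h ^+ 2)^-1 * ((C + h) * (C + h))).
apply: T => //.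
- by apply: measurable_funM => //; exact: measurable_funM.
- have hC0 : 0 <= (h ^+ 2)^-1 * ((C + h) * (C + h)).
    by rewrite !mulr_ge0// addr_ge0// ltW.
  under eq_integral do rewrite mulrAC EFinM.
  rewrite ge0_integralZl//; last 2 first.
  + exact/measurable_EFinP.
  + by move=> x _; rewrite lee_fin.
  by have [_ _ ->] := hp; rewrite mule1.
Qed.

Lemma l1sup_overlap :
  l1sup (mu \x mu)%E overlap ((h ^+ 2)^-1 * ((C + h) * (C + h))).
Proof.
have [_ _] := minkowski_U; congr (l1sup _ _ _).
by apply/funext => z; rewrite overlapE.
Qed.

(** For each sample point the two kernels integrate to 1 separately, so the total
    mass does not depend on the bandwidth although the supremum is of order
    1 / h. *)
Lemma integral_overlap : \int[(mu \x mu)%E]_z overlap z = 1.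
Proof.
have [i1 i2 _] := minkowski_U.
have i3 u := l1sup_integrable (l1sup_U u).
have [_ e1 e2] := Rintegral_swap i1 i3 i2.
under eq_Rintegral do rewrite overlapE.
rewrite e2 -e1 -[RHS]p1; apply: eq_Rintegral => u _.
have [T E] := l1sup_tensor (l1sup_dilate u) (l1sup_dilate u).
have ed : \int[mu]_x dilate h u x = h by rewrite /Rintegral integral_dilate.
have := RintegralZl ((h ^+ 2)^-1 * p u) measurableT (l1sup_integrable T).
rewrite E ed => e3.
have -> : p u = (h ^+ 2)^-1 * p u * (h * h) by field.
by rewrite -e3; apply: eq_Rintegral => z _; rewrite /U /=; ring.
Qed.

Variables (N : nat) (N0 : (0 < N)%N) (h1 : h <= 1).
Let Nr0 : 0 < N%:R :> R. Proof. by rewrite ltr0n. Qed.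
Let Nrn0 : N%:R != 0 :> R. Proof. exact: lt0r_neq0. Qed.
Let e : R := (N%:R * h)^-1.
Let e0 : 0 <= e. Proof. by rewrite invr_ge0 mulr_ge0// ltW. Qed.
Let NV0 : 0 <= N%:R^-1 :> R. Proof. by rewrite invr_ge0. Qed.
Let NVE : N%:R^-1 = h * e. Proof. by rewrite /e; field; exact/andP. Qed.

Local Notation f := (smooth K h p).

Lemma l1sup_smooth_density : l1sup mu f b.
Proof.
have [] := @smooth_l1sup R K mK K0 h p b 1 _ pb; first by rewrite K1.
by move=> _; rewrite mul1r.
Qed.

(** The covariance of the values of the estimator at the two coordinates. *)
Definition fluctuation (z : R * R) : R :=
  N%:R^-1 * (overlap z - f z.1 * f z.2).

Let b0 : 0 <= b. Proof. exact: l1sup_ge0 pb. Qed.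
Let f0 x : 0 <= f x. Proof. exact: smooth_ge0. Qed.
Let fb x : f x <= b.
Proof.
by case: l1sup_smooth_density => _ /(_ x) + _; apply: le_trans; exact: ler_norm.
Qed.

Let tensor_f := l1sup_tensor l1sup_smooth_density l1sup_smooth_density.

Lemma measurable_fluctuation : measurable_fun setT fluctuation.
Proof.
apply: measurable_funM => //; apply: measurable_funB.
  by case: l1sup_overlap.
by case: tensor_f => -[].
Qed.

Let fluctuation_le z :
  `|fluctuation z| <= N%:R^-1 * (overlap z + f z.1 * f z.2).
Proof.
rewrite /fluctuation normrM (ger0_norm NV0); apply: (ler_wpM2l NV0).
apply: le_trans (ler_normB _ _) _.
by rewrite (ger0_norm (overlap_ge0 z)) ger0_norm ?mulr_ge0.
Qed.

Lemma fluctuation_sup z : `|fluctuation z| <= (C * b + b ^+ 2) * e.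
Proof.
apply: le_trans (fluctuation_le z) _.
have -> : (C * b + b ^+ 2) * e = N%:R^-1 * (C / h * b) + b ^+ 2 * e.
  by rewrite mulrDl; congr (_ + _); rewrite /e; field; exact/andP.
rewrite mulrDr lerD//.
  apply: (ler_wpM2l NV0).
  apply: le_trans (overlap_le z) _.
  by rewrite ler_wpM2l// divr_ge0// ltW.
rewrite mulrC ler_pM ?mulr_ge0//.
  by rewrite expr2 ler_pM.
by rewrite NVE ler_piMl.
Qed.

(** A factor [h] better than the uniform bound, because [overlap] has mass 1. *)
Lemma fluctuation_int :
  (\int[(mu \x mu)%E]_z `|fluctuation z|%:E <= ((1 + b ^+ 2) * h * e)%:E)%E.
Proof.
have [T E] := tensor_f.
have i1 := l1sup_integrable l1sup_overlap; have i2 := l1sup_integrable T.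
have i12 : (mu \x mu)%E.-integrable setT
    (EFin \o (fun z => overlap z + f z.1 * f z.2)).
  exact: (integrableD measurableT i1 i2).
have i3 : (mu \x mu)%E.-integrable setT
    (EFin \o (fun z => N%:R^-1 * (overlap z + f z.1 * f z.2))).
  exact: (integrableZl measurableT N%:R^-1 i12).
apply: (@le_trans _ _ (\int[(mu \x mu)%E]_z
    (N%:R^-1 * (overlap z + f z.1 * f z.2))%:E)%E).
  apply: ge0_le_integral => //.
  - apply/measurable_EFinP; apply: measurableT_comp => //.
    exact: measurable_fluctuation.
  - exact: (measurable_int _ i3).
  - by move=> z _; rewrite lee_fin.
rewrite -[leLHS]fineK; last exact: (integrable_fin_num measurableT i3).
rewrite lee_fin.
have -> : fine (\int[(mu \x mu)%E]_z (N%:R^-1 * (overlap z + f z.1 * f z.2))%:E)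
    = N%:R^-1 * (\int[(mu \x mu)%E]_z overlap z
      + \int[(mu \x mu)%E]_z (f z.1 * f z.2)).
  rewrite -RintegralD//; exact: (RintegralZl _ measurableT i12).
rewrite integral_overlap E NVE mulrC -mulrA ler_wpM2r ?mulr_ge0 ?(ltW h0)//.
rewrite lerD2l expr2; have := l1sup_Rintegral l1sup_smooth_density.
by rewrite ger0_norm ?Rintegral_ge0// => ?; rewrite ler_pM ?Rintegral_ge0.
Qed.

Variables (p' : R -> R) (b' : R).
Hypotheses (dp : forall y : R, is_derive y 1 p (p' y)) (cp' : continuous p')
  (pb' : l1sup mu p' b').

(** On the diagonal [overlap] is the smoothing of the density by the squared
    kernel, over [h]: its leading term is the density times the integral of the
    squared kernel. *)
Lemma fluctuation_diag : l1sup mu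
  (fun x => fluctuation (x, x) - e * (\int[mu]_t K t ^+ 2) * p x)
  ((C * abs_moment K 1 * b' + b ^+ 2) * h * e).
Proof.
have iK2 : mu.-integrable setT (EFin \o (fun t => K t ^+ 2)).
  apply/integrableP; split; first exact/measurable_EFinP.
  by under eq_integral do rewrite /= ger0_norm ?exprn_ge0//; case: hK.
have im1 := kernel_moments hK (isT : (1 <= 3)%N).
have kc1 : (\int[mu]_t (K t ^+ 2 * `|t|)%:E <= (C * abs_moment K 1)%:E)%E.
  rewrite EFinM /abs_moment fineK; last first.
    exact: (integrable_fin_num measurableT im1).
  have mm1 : measurable_fun setT (fun t : R => (`|t| ^+ 1 * K t)%:E).
    exact: measurable_int im1.
  rewrite -ge0_integralZl//; last by move=> t _; rewrite lee_fin mulr_ge0.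
  apply: ge0_le_integral => //.
  - by move=> t _; rewrite lee_fin mulr_ge0// exprn_ge0.
  - by apply/measurable_EFinP; apply: measurable_funM => //; exact: measurableT_comp.
  - exact: emeasurable_funM.
  - move=> t _; rewrite -EFinM lee_fin.
    have -> : K t ^+ 2 * `|t| = K t * (`|t| ^+ 1 * K t) by ring.
    by rewrite ler_wpM2r// mulr_ge0.
have B := @smooth_bias1 R (fun t => K t ^+ 2) mK2 (fun t => exprn_ge0 2 (K0 t))
  p p' b iK2 pb dp h _ b' (ltW h0) cp' pb' kc1.
have B' := l1supZ e B.
have FF := l1supZ (h * e) (l1supM l1sup_smooth_density l1sup_smooth_density).
apply: (l1sup_eq (l1supB B' FF)).
  by move=> x; rewrite /fluctuation overlap_diag NVE /=; field.
rewrite !ger0_norm ?mulr_ge0 ?(ltW h0)//.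
by rewrite le_eqVlt; apply/orP; left; apply/eqP; ring.
Qed.

End KernelDensity.

(** * The risk in terms of the second moment *)

Section BoundedFubini.
Context d1 d2 (S : measurableType d1) (T : measurableType d2) (R : realType).
Variables (P : probability S R) (m : {sigma_finite_measure set T -> \bar R}).

Lemma expectation_Rintegral (U : S * T -> R) c : measurable_fun setT U ->
  (forall w, l1sup m (fun x => U (w, x)) c) ->
  P.-integrable setT (fun w => (\int[m]_x U (w, x))%:E) /\
  \int[P]_w \int[m]_x U (w, x) = \int[m]_x \int[P]_w U (w, x).
Proof.
move=> mU Uc.
have Pc : (\int[P]_w (cst c w)%:E <= c%:E)%E.
  have -> : (\int[P]_w (cst c w)%:E = c%:E * P setT)%E by rewrite /= integral_cst.
  by rewrite probability_setT mule1.
have [] := @minkowski _ _ _ _ R P m U (cst c) c mU _ Uc Pc; first by [].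
move=> i1 i2 _.
have i3 w := l1sup_integrable (Uc w).
by have [j1 -> ->] := Rintegral_swap i1 i3 i2.
Qed.

End BoundedFubini.

Section Representation.
Context d (T : measurableType d) (R : realType) (P : probability T R).
Local Notation mu := (@lebesgue_measure R).
Context (M : nat) (M0 : (0 < M)%N) (p : 'I_M -> R -> R) (K : R -> R)
  (N : 'I_M -> nat) (h : 'I_M -> R) (X : 'I_M -> nat -> {RV P >-> R}).
Variables (C b cpi : R).
Hypotheses (hpdf : forall m, is_pdf (p m)) (pb : forall m, l1sup mu (p m) b).
Hypotheses (hK : kde_kernel K) (KC : forall t, 0 <= K t <= C).
Hypotheses (N0 : forall m, (0 < N m)%N) (h0 : forall m, 0 < h m).
Hypotheses (hX : sample p N X) (lambda0 : 0 < prod_mass p)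
  (pi_c : l1sup mu (norm_prod p) cpi).

Let K0 t : 0 <= K t. Proof. by case/andP: (KC t). Qed.
Let C0 : 0 <= C. Proof. by case/andP: (KC 0); exact: le_trans. Qed.
Let mK : measurable_fun setT K. Proof. by case: hK. Qed.
Let Nr0 m : 0 < (N m)%:R :> R. Proof. by rewrite ltr0n. Qed.
Let e m : R := ((N m)%:R * h m)^-1.
Let e0 m : 0 <= e m. Proof. by rewrite invr_ge0 mulr_ge0// ltW. Qed.

Let f m := smooth K (h m) (p m).
Let r m := fluctuation K (h m) (p m) (N m).
Let Q := cross_moment f r.

Let phat w m := kde K (N m) (h m) (fun i => X m i w).

Let phatE w m x : phat w m x = \sum_(i < N m) e m * dilate K (h m) (X m i w) x.
Proof. by rewrite /phat /kde mulr_sumr. Qed.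

Let phat_ge0 w m x : 0 <= phat w m x.
Proof. by rewrite phatE sumr_ge0// => i _; rewrite mulr_ge0// K0. Qed.

Let expectation_phat (x y : R) :
  (\int[P]_w (\prod_m (phat w m x * phat w m y))%:E = (Q (x, y))%:E)%E.
Proof.
pose a x m u := e m * dilate K (h m) u x.
pose B := \sum_m e m * C.
have aB z m u : 0 <= a z m u <= B.
  rewrite mulr_ge0//= ?K0// /B (bigD1 m)//=.
  apply: (@le_trans _ _ (e m * C)); last first.
    by rewrite lerDl sumr_ge0// => j _; rewrite mulr_ge0.
  by rewrite ler_wpM2l//; case/andP: (KC ((z - u) / h m)).
have ma z m : measurable_fun setT (a z m).
  apply: measurable_funM => //.
  exact: (@measurable_dilate_l R K hK (h m) z).
have := expectation_prod_sums hpdf hX (ma x) (ma y) (aB x) (aB y).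
under eq_integral => w _ do under eq_bigr => m _ do rewrite -!phatE.
move=> ->; congr EFin; apply: eq_bigr => m _.
have ia z : \int[mu]_u (p m u * a z m u) = (N m)%:R^-1 * f m z.
  have dC u : 0 <= dilate K (h m) u z <= C by exact: KC.
  have i1 := integrable_density (hpdf m) (pb m)
    (@measurable_dilate_l R K hK (h m) z) dC.
  transitivity (\int[mu]_u (e m * (p m u * dilate K (h m) u z))).
    by apply: eq_Rintegral => u _; rewrite /a; ring.
  rewrite RintegralZl// (integral_density_dilate hK KC (h0 m) (hpdf m)).
  by rewrite /e /f; field; rewrite !gt_eqF.
have iab : \int[mu]_u (p m u * (a x m u * a y m u)) =
    (N m)%:R^-1 ^+ 2 * overlap K (h m) (p m) (x, y).
  have dC u : 0 <= dilate K (h m) u x * dilate K (h m) u y <= C * C.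
    have /andP[d1 d2] := KC ((x - u) / h m).
    have /andP[d3 d4] := KC ((y - u) / h m).
    by rewrite mulr_ge0//= ler_pM.
  have mdd : measurable_fun setT
      (fun u => dilate K (h m) u x * dilate K (h m) u y).
    by apply: measurable_funM; exact: measurable_dilate_l.
  have i1 := integrable_density (hpdf m) (pb m) mdd dC.
  transitivity (\int[mu]_u
    (e m ^+ 2 * (p m u * (dilate K (h m) u x * dilate K (h m) u y)))).
    by apply: eq_Rintegral => u _; rewrite /a; ring.
  rewrite RintegralZl// /overlap/=.
  by rewrite /e; field; rewrite !gt_eqF.
rewrite !ia iab /r /fluctuation /=.
by rewrite -!/(f _ _); field; rewrite gt_eqF.
Qed.

Let B : R := 1 + \sum_m e m * ((N m)%:R * (C + h m)).
Let B0 : 0 <= B.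
Proof.
by rewrite addr_ge0// sumr_ge0// => m _; rewrite !mulr_ge0// addr_ge0// ltW.
Qed.

Let l1sup_phat w m : l1sup mu (phat w m) B.
Proof.
have D i := l1supZ (e m) (l1sup_dilate hK KC (h0 m) (X m i w)).
have S := l1sup_sum (index_enum 'I_(N m)) (fun i : 'I_(N m) => D i).
apply: (l1sup_eq S); first by move=> x; rewrite phatE.
rewrite sumr_const card_ord ger0_norm// /B (bigD1 m)//= -[leLHS]mulr_natl mulrCA.
rewrite addrCA lerDl addr_ge0// sumr_ge0// => j _.
by rewrite !mulr_ge0// addr_ge0// ltW.
Qed.

Let pstar w := prod_fun (phat w).
Let l1sup_pstar w : l1sup mu (pstar w) (B ^+ M).
Proof. exact: (l1sup_prod_fun M0 (l1sup_phat w)). Qed.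

Let pstar_ge0 w x : 0 <= pstar w x.
Proof. by apply: prodr_ge0 => m _. Qed.

Let measurable_pstar d' (Y : measurableType d') (g : Y -> R) :
  measurable_fun setT g ->
  measurable_fun setT (fun z : T * Y => pstar z.1 (g z.2)).
Proof.
move=> mg; apply: measurable_prod => m _.
under eq_fun do rewrite phatE.
apply: measurable_sum => i; apply: measurable_funM => //.
apply: (@measurableT_comp _ _ _ _ _ _ (fun z : R * R => dilate K (h m) z.1 z.2) _
    (fun z : T * Y => (X m i z.1, g z.2))); first exact: measurable_dilate2.
by apply: measurable_fun_pair; exact: measurableT_comp.
Qed.

Local Notation lam := (prod_mass p).
Local Notation pi := (norm_prod p).
Let lam_neq0 : lam != 0. Proof. exact: lt0r_neq0. Qed.

(* Each product of integrals is written as one integral over the plane, so that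
   the expectation can be taken under the integral sign. *)
Let risk w : R := (lam ^+ 2)^-1 * (\int[mu]_x (pstar w x * pstar w x)
  - 2 * \int[(mu \x mu)%E]_z (pi z.1 * pstar w z.1 * pstar w z.2)
  + (\int[mu]_x (pi x ^+ 2)) *
    \int[(mu \x mu)%E]_z (pstar w z.1 * pstar w z.2)).

(** For a nonzero mass the square of the mass cancels the normalisation of the
    estimator. For zero mass the left-hand side is 0; so is the right-hand side,
    because a nonnegative function bounded by B^M has a square whose integral
    is at most B^M times its integral. *)
Let riskE w : (prod_mass (phat w) / lam) ^+ 2 *
    \int[mu]_x (norm_prod (phat w) x - pi x) ^+ 2 = risk w.
Proof.
have L := l1sup_pstar w.
have [_ T1] := l1sup_tensor (l1supM pi_c L) L.
have [_ T2] := l1sup_tensor L L.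
rewrite /risk T1 T2 -/(prod_mass (phat w)).
set lh := prod_mass (phat w).
have CS : \int[mu]_x (center pi (pstar w) x ^+ 2) =
    \int[mu]_x (pstar w x * pstar w x) -
    2 * (\int[mu]_x (pi x * pstar w x) * lh) +
    (\int[mu]_x (pi x ^+ 2)) * (lh * lh).
  rewrite (integral_center_sq pi_c L) -/(prod_mass (phat w)) -/lh.
  by ring.
rewrite -CS.
have [lh0|lh0] := eqVneq lh 0.
  have -> : (lh / lam) ^+ 2 = 0 by rewrite lh0 mul0r expr0n.
  rewrite mul0r.
  have -> : \int[mu]_x (center pi (pstar w) x ^+ 2) = 0.
    transitivity (\int[mu]_x (pstar w x * pstar w x)).
      apply: eq_Rintegral => x _.
      by rewrite /center -/(prod_mass (phat w)) -/lh lh0 mul0r subr0 expr2.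
    apply/eqP; rewrite eq_le; apply/andP; split; last first.
      by apply: Rintegral_ge0 => x _; exact: mulr_ge0.
    have <- : B ^+ M * lh = 0 by rewrite lh0 mulr0.
    rewrite /lh /prod_mass -RintegralZl//; last exact: l1sup_integrable L.
    apply: le_Rintegral => //.
    - exact: l1sup_integrable (l1supM L L).
    - exact: l1sup_integrable (l1supZ (B ^+ M) L).
    - move=> x _; apply: ler_wpM2r; first exact: pstar_ge0.
      have [_ /(_ x) + _] := L; apply: le_trans; exact: ler_norm.
  by rewrite mulr0.
have -> : \int[mu]_x (norm_prod (phat w) x - pi x) ^+ 2 =
    lh ^- 2 * \int[mu]_x (center pi (pstar w) x ^+ 2).
  have CL := l1sup_center pi_c L.
  rewrite -RintegralZl//; last exact: l1sup_integrable (l1supM CL CL).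
  apply: eq_Rintegral => x _.
  rewrite /center -/(prod_mass (phat w)) -/lh /norm_prod -/lh -/(pstar w x).
  by field; rewrite lh0 lam_neq0.
by field; rewrite lh0 lam_neq0.
Qed.

(** The risk is a quadratic functional of the product of the estimators, so its
    mean is the same linear functional applied to the second moment [Q]. *)
Lemma MISE_barE : MISE_bar p K N h X = ((lam ^+ 2)^-1 *
  (\int[mu]_x Q (x, x) - 2 * \int[(mu \x mu)%E]_z (pi z.1 * Q z)
   + (\int[mu]_x (pi x ^+ 2)) * \int[(mu \x mu)%E]_z Q z))%:E.
Proof.
have mp1 : measurable_fun setT (fun z : T * (R * R) => pstar z.1 z.2.1).
  exact: (measurable_pstar (@measurable_fst _ _ R R)).
have mp2 : measurable_fun setT (fun z : T * (R * R) => pstar z.1 z.2.2).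
  exact: (measurable_pstar (@measurable_snd _ _ R R)).
have mp0 : measurable_fun setT (fun z : T * R => pstar z.1 z.2).
  exact: (measurable_pstar (@measurable_id _ R setT)).
have mpi : measurable_fun setT (fun z : T * (R * R) => pi z.2.1).
  case: pi_c => mpi _ _; apply: (measurableT_comp mpi).
  exact: measurableT_comp.
have [j1 E1] := @expectation_Rintegral _ _ _ _ R P mu
  (fun z => pstar z.1 z.2 * pstar z.1 z.2) _ (measurable_funM mp0 mp0)
  (fun w => l1supM (l1sup_pstar w) (l1sup_pstar w)).
have [j2 E2] := @expectation_Rintegral _ _ _ _ R P (sf_product mu mu)
  (fun z => pi z.2.1 * pstar z.1 z.2.1 * pstar z.1 z.2.2) _
  (measurable_funM (measurable_funM mpi mp1) mp2)
  (fun w => (l1sup_tensor (l1supM pi_c (l1sup_pstar w)) (l1sup_pstar w)).1).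
have [j3 E3] := @expectation_Rintegral _ _ _ _ R P (sf_product mu mu)
  (fun z => pstar z.1 z.2.1 * pstar z.1 z.2.2) _ (measurable_funM mp1 mp2)
  (fun w => (l1sup_tensor (l1sup_pstar w) (l1sup_pstar w)).1).
have EQ x y : \int[P]_w (pstar w x * pstar w y) = Q (x, y).
  rewrite /Rintegral -[RHS]/(fine (Q (x, y))%:E) -expectation_phat.
  by congr fine; apply: eq_integral => w _; rewrite /pstar /prod_fun -big_split.
have iEQ x y : P.-integrable setT (fun w => (pstar w x * pstar w y)%:E).
  have m1 z : measurable_fun setT (fun w => pstar w z).
    exact: (measurableT_comp mp0 (measurable_pair2 z)).
  apply/integrableP; split; first by apply/measurable_EFinP; exact: measurable_funM.
  under eq_integral do rewrite /= ger0_norm ?mulr_ge0//.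
  apply: (@le_lt_trans _ _ (Q (x, y))%:E); last exact: ltry.
  rewrite -expectation_phat le_eqVlt; apply/orP; left; apply/eqP.
  by apply: eq_integral => w _; rewrite /pstar /prod_fun -big_split.
pose S := \int[mu]_x (pi x ^+ 2); pose A w := \int[mu]_x (pstar w x * pstar w x).
pose A2 w := \int[(mu \x mu)%E]_z (pi z.1 * pstar w z.1 * pstar w z.2).
pose A3 w := \int[(mu \x mu)%E]_z (pstar w z.1 * pstar w z.2).
have k1 : P.-integrable setT (EFin \o A) by exact: j1.
have k2 : P.-integrable setT (EFin \o A2) by exact: j2.
have k3 : P.-integrable setT (EFin \o A3) by exact: j3.
have k2' : P.-integrable setT (EFin \o (fun w => 2 * A2 w)).
  exact: (integrableZl measurableT 2 k2).
have k3' : P.-integrable setT (EFin \o (fun w => S * A3 w)).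
  exact: (integrableZl measurableT S k3).
have k12 : P.-integrable setT (EFin \o (fun w => A w - 2 * A2 w)).
  exact: (integrableB measurableT k1 k2').
have k123 : P.-integrable setT (EFin \o (fun w => A w - 2 * A2 w + S * A3 w)).
  exact: (integrableD measurableT k12 k3').
have kr : P.-integrable setT (EFin \o risk).
  exact: (integrableZl measurableT (lam ^+ 2)^-1 k123).
have -> : MISE_bar p K N h X = (\int[P]_w (risk w)%:E)%E.
  rewrite /MISE_bar unlock; apply: eq_integral => w _; congr EFin.
  exact: riskE.
rewrite -[LHS]fineK; last exact: integrable_fin_num kr.
congr EFin.
transitivity ((lam ^+ 2)^-1 *
    (\int[P]_w A w - 2 * \int[P]_w A2 w + S * \int[P]_w A3 w)).
  rewrite -(RintegralZl 2)// -(RintegralZl S)// -RintegralB// -RintegralD//.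
  exact: (RintegralZl _ measurableT k123).
congr (_ * (_ - 2 * _ + _ * _)).
- by rewrite /A E1; apply: eq_Rintegral => x _; exact: EQ.
- rewrite [LHS]E2; apply: eq_Rintegral => -[x y] _ /=.
  rewrite -EQ -RintegralZl//.
    by apply: eq_Rintegral => w _; rewrite /= mulrA.
  exact: iEQ.
- by rewrite [LHS]E3; apply: eq_Rintegral => -[x y] _; exact: EQ.
Qed.

End Representation.

(** * The error bound, uniform in sample sizes and bandwidths *)

Section SmoothDensities.
Context (R : realType) (M : nat).
Local Notation mu := (@lebesgue_measure R).
Variable p : 'I_M -> R -> R.
Hypotheses (hsmooth : forall m, smooth_density (p m)).

Lemma derive1n_is_derive m s : (s < 3)%N ->
  forall y : R, is_derive y 1 (derive1n s (p m)) (derive1n s.+1 (p m) y).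
Proof.
move=> s3 y; have [[dp _] _] := hsmooth m.
by apply: DeriveDef; [exact: dp|rewrite derive1nS derive1E].
Qed.

Lemma continuous_derive1n m s : (s <= 3)%N -> continuous (derive1n s (p m)).
Proof.
rewrite leq_eqVlt => /orP[/eqP->|s3]; first by have [[_ cp] _] := hsmooth m.
move=> y; apply/differentiable_continuous/derivable1_diffP.
by have [[dp _] _] := hsmooth m; exact: dp.
Qed.

Lemma l1sup_derivatives : exists2 b, 0 <= b &
  forall m s, (s <= 3)%N -> l1sup mu (derive1n s (p m)) b.
Proof.
have H (ms : 'I_M * 'I_4) : exists b, l1sup mu (derive1n ms.2 (p ms.1)) b.
  have s3 : (ms.2 <= 3)%N by rewrite -ltnS.
  have [[c hc] ip] := (hsmooth ms.1).2 _ s3.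
  have mf : measurable_fun setT (derive1n ms.2 (p ms.1)).
    exact: continuous_measurable_fun (@continuous_derive1n ms.1 _ s3).
  have := integrable_norm ip => ipn.
  have fn := integrable_fin_num measurableT ipn.
  exists (`|c| + \int[mu]_x `|derive1n ms.2 (p ms.1) x|); split=> //.
    move=> x; apply: le_trans (hc x) _; apply: le_trans (ler_norm c) _.
    by rewrite lerDl; apply: Rintegral_ge0 => y _.
  have -> : (\int[mu]_x `|derive1n ms.2 (p ms.1) x|%:E)%E =
    (\int[mu]_x `|derive1n ms.2 (p ms.1) x|)%:E by rewrite fineK.
  by rewrite lee_fin lerDr.
have [B HB] := choice H.
have B0 ms : 0 <= B ms by exact: l1sup_ge0 (HB ms).
exists (\sum_ms B ms); first by rewrite sumr_ge0.
move=> m s s3; have s4 : (s < 4)%N by rewrite ltnS.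
apply: (le_l1sup _ (HB (m, Ordinal s4))).
by rewrite [leRHS](bigD1 (m, Ordinal s4))//= lerDl sumr_ge0.
Qed.

End SmoothDensities.

Section UniformError.
Context (R : realType) (M : nat) (M0 : (0 < M)%N).
Local Notation mu := (@lebesgue_measure R).
Variables (p : 'I_M -> R -> R) (K : R -> R).
Hypotheses (hpdf : forall m, is_pdf (p m))
  (hsmooth : forall m, smooth_density (p m)) (lambda0 : 0 < prod_mass p)
  (hK : kde_kernel K).
Context d (T : measurableType d) (P : probability T R).

Local Notation lam := (prod_mass p).
Local Notation pi := (norm_prod p).
Let lam_neq0 : lam != 0. Proof. exact: lt0r_neq0. Qed.
Let k := abs_moment K 2 / 2.
Let kappa := \int[mu]_t K t ^+ 2.
Let p2 m := derive1n 2 (p m).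
Let e N h (m : 'I_M) : R := ((N m)%:R * h m)^-1.

(** The three terms of the AMISE that involve the bias are the expansion of the
    integral of its centred square. *)
Lemma AMISE_barE (N : 'I_M -> nat) (h : 'I_M -> R) a1 a2 cpi :
  l1sup mu (first_order p p2 k h) a1 -> l1sup mu (first_variance p (e N h)) a2 ->
  l1sup mu pi cpi ->
  AMISE_bar p K N h = (lam ^+ 2)^-1 *
    (\int[mu]_x (center pi (first_order p p2 k h) x ^+ 2)
     + kappa * \int[mu]_x first_variance p (e N h) x).
Proof.
set D := first_order _ _ _ _; set V := first_variance _ _ => D1 V1 pi_c.
have BE x : bias p K h x = lam^-1 * D x by rewrite /bias /D /first_order /k; ring.
have VE x : var p N h x = (lam^-1 ^+ 2) * V x by [].
have iD := l1sup_integrable D1; have iV := l1sup_integrable V1.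
have B1 := l1supZ lam^-1 D1.
have iDD := l1sup_integrable (l1supM D1 D1).
rewrite (integral_center_sq pi_c D1) /AMISE_bar.
have -> : \int[mu]_x bias p K h x = lam^-1 * \int[mu]_x D x.
  by rewrite -RintegralZl//; apply: eq_Rintegral => x _; exact: BE.
have -> : \int[mu]_x (bias p K h x) ^+ 2 = lam^-1 ^+ 2 * \int[mu]_x (D x ^+ 2).
  rewrite -RintegralZl//; apply: eq_Rintegral => x _.
  by rewrite BE exprMn.
have -> : \int[mu]_x var p N h x = lam^-1 ^+ 2 * \int[mu]_x V x.
  by rewrite -RintegralZl//; apply: eq_Rintegral => x _; exact: VE.
have -> : \int[(mu \x mu)%E]_z (bias p K h z.2 * bias p K h z.1 * pi z.1) =
    lam^-1 ^+ 2 * (\int[mu]_x D x * \int[mu]_x (pi x * D x)).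
  have [_ Tn] := l1sup_tensor (l1supM pi_c D1) D1.
  have [T1 _] := l1sup_tensor (l1supM pi_c D1) D1.
  rewrite [\int[mu]_x D x * _]mulrC -Tn -RintegralZl//; last exact: l1sup_integrable T1.
  by apply: eq_Rintegral => z _; rewrite !BE; ring.
by rewrite -/kappa; field.
Qed.

Let l1sup_norm_prod b0 : (forall m, l1sup mu (p m) b0) ->
  l1sup mu pi (lam^-1 * b0 ^+ M).
Proof.
move=> pb; have := l1supZ lam^-1 (l1sup_prod_fun M0 pb).
by rewrite ger0_norm// invr_ge0 ltW.
Qed.

Lemma MISE_bar_fin_num (N : 'I_M -> nat) (h : 'I_M -> R)
    (X : 'I_M -> nat -> {RV P >-> R}) :
  (forall m, (0 < N m)%N) -> (forall m, 0 < h m) -> sample p N X ->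
  MISE_bar p K N h X \is a fin_num.
Proof.
move=> N0 h0 hX; have [b0 _ hb] := l1sup_derivatives hsmooth.
have [C KC] := kernel_bounded hK.
have pb m : l1sup mu (p m) b0 := hb m 0%N isT.
by rewrite (MISE_barE M0 hpdf pb hK KC N0 h0 hX lambda0 (l1sup_norm_prod pb)).
Qed.

(** The constant depends neither on the sample sizes nor on the bandwidths, nor
    on the samples: this is what makes the bound usable along a sequence. *)
Lemma MISE_bar_expansion : exists A : R, forall (N : 'I_M -> nat)
    (h : 'I_M -> R) (X : 'I_M -> nat -> {RV P >-> R}) (H eta : R),
  (forall m, (0 < N m)%N) -> (forall m, 0 < h m) -> sample p N X ->
  (forall m, h m <= H) -> H <= 1 ->
  (forall m, e N h m <= eta) -> eta <= 1 ->
  exists2 E, MISE_bar p K N h X = (AMISE_bar p K N h + E)%:E &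
    `|E| <= A * (H ^+ 5 + H * eta + eta ^+ 2).
Proof.
have [b0 b00 hb] := l1sup_derivatives hsmooth.
have [C KC] := kernel_bounded hK.
have C0 : 0 <= C by case/andP: (KC 0); exact: le_trans.
have K0 t : 0 <= K t by case/andP: (KC t).
have mK : measurable_fun setT K by case: hK.
have iK : mu.-integrable setT (EFin \o K).
  apply/integrableP; split; first exact/measurable_EFinP.
  by under eq_integral do rewrite /= ger0_norm//; rewrite kernel_mass// ltry.
have mom0 s : 0 <= abs_moment K s.
  by apply: Rintegral_ge0 => t _; rewrite mulr_ge0// exprn_ge0.
pose k1 := abs_moment K 1; pose k3 := abs_moment K 3.
have k10 : 0 <= k1 by exact: mom0.
have k30 : 0 <= k3 by exact: mom0.
have kap0 : 0 <= kappa by apply: Rintegral_ge0 => t _; rewrite exprn_ge0.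
have kk0 : 0 <= k by rewrite divr_ge0// mom0.
have it3 : (\int[mu]_t (K t * `|t| ^+ 3)%:E <= k3%:E)%E.
  rewrite /k3 /abs_moment fineK; last first.
    exact: (integrable_fin_num measurableT (kernel_moments hK (isT : (3 <= 3)%N))).
  by under eq_integral do rewrite mulrC.
have it2 : mu.-integrable setT (fun t => (t ^+ 2 * K t)%:E).
  have := kernel_moments hK (isT : (2 <= 3)%N); congr (integrable _ _ _).
  by apply/funext => t; rewrite real_normK ?num_real.
have it1 : mu.-integrable setT (fun t => (t * K t)%:E).
  apply: le_integrable (kernel_moments hK (isT : (1 <= 3)%N)) => //.
    by apply/measurable_EFinP; exact: measurable_funM.
  by move=> t _; rewrite lee_fin expr1 !normrM normr_id.
have m1 : \int[mu]_t (t * K t) = 0 by rewrite /Rintegral kernel_centered.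
pose cpi := lam^-1 * b0 ^+ M.
have pb m : l1sup mu (p m) b0 by have := hb m 0%N isT.
have pi_c : l1sup mu pi cpi by exact: l1sup_norm_prod.
have piE x : prod_fun p x = lam * pi x by rewrite /norm_prod; field.
(* The expansion of the second moment takes a single constant for all its
   bounds: b is the sum of the bounds for the densities, the kernel moments, and
   the uniform, integral and diagonal errors of the covariances. *)
pose b := 1 + b0 + k + kappa + k3 * b0 + (C * b0 + b0 ^+ 2) + b0 ^+ 2
  + C * k1 * b0.
have t1 : 0 <= k3 * b0 by exact: mulr_ge0.
have t2 : 0 <= C * b0 by exact: mulr_ge0.
have t3 : 0 <= b0 ^+ 2 by exact: exprn_ge0.
have t4 : 0 <= C * k1 * b0 by rewrite !mulr_ge0.
exists ((lam ^+ 2)^-1 * c_expansion M b cpi).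
move=> N h X H eta N0 h0 hX hH H1 he eta1; pose i0 := Ordinal M0.
have e0 m : 0 <= e N h m by rewrite invr_ge0 mulr_ge0// ltW.
have H0 : 0 <= H by apply: le_trans (hH i0); exact: ltW.
have eta0 : 0 <= eta by exact: le_trans (he i0).
have h1 m : h m <= 1 by exact: le_trans (hH m) H1.
have b1 : 1 <= b by rewrite /b; lra.
have b0b : b0 <= b by rewrite /b; lra.
have kb : `|k| <= b.
  by rewrite ger0_norm// /b; lra.
have kapb : `|kappa| <= b.
  by rewrite ger0_norm// /b; lra.
have b3 : k3 * b0 <= b by rewrite /b; lra.
have b4 : C * b0 + b0 ^+ 2 <= b by rewrite /b; lra.
have b5 : 1 + b0 ^+ 2 <= b by rewrite /b; lra.
have b6 : C * k1 * b0 + b0 ^+ 2 <= b.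
  by rewrite /b; lra.
have bge0 : 0 <= b by exact: le_trans b1.
have hH' m : 0 <= h m <= H by rewrite ltW//= hH.
have he' m : 0 <= e N h m <= eta by rewrite e0 he.
have hehe m : h m * e N h m <= H * eta by rewrite ler_pM// ltW.
have pb' m : l1sup mu (p m) b by exact: le_l1sup (pb m).
have p2b' m : l1sup mu (p2 m) b by exact: le_l1sup (hb m 2%N isT).
pose f m := smooth K (h m) (p m).
pose r m := fluctuation K (h m) (p m) (N m).
have fb m : l1sup mu (f m) b.
  exact: le_l1sup (l1sup_smooth_density hK KC (h m) (pb m)).
have f_bias m : l1sup mu (fun x => f m x - (p m x + h m ^+ 2 * k * p2 m x))
    (b * H ^+ 3).
  have SB := smooth_bias3 mK K0 iK (pb m) (@derive1n_is_derive _ _ _ hsmooth m 0 isT)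
    (@derive1n_is_derive _ _ _ hsmooth m 1 isT)
    (@derive1n_is_derive _ _ _ hsmooth m 2 isT) (ltW (h0 m))
    (@continuous_derive1n _ _ _ hsmooth m 3 isT) (hb m 3 isT).
  have mder s : (s <= 3)%N -> measurable_fun setT (derive1n s (p m)).
    by move=> s3; case: (hb m s s3).
  have := SB _ (mder 1%N isT) (mder 2%N isT) it1 it2 m1 it3.
  rewrite (Rintegral_kernel hK) (abs_moment2E K).
  move=> L; apply: (l1sup_eq L); first by move=> x; rewrite /f /p2 /k mul1r.
  rewrite mulrCA [leLHS]mulrC; apply: ler_pM => //.
    by rewrite exprn_ge0// ltW.
  by rewrite lerXn2r// nnegrE// ltW.
have MI := MISE_barE M0 hpdf pb hK KC N0 h0 hX lambda0 pi_c.
have mr m : measurable_fun setT (r m).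
  exact: (measurable_fluctuation hK KC (h0 m) (hpdf m) (pb m)).
have r_sup m z : `|r m z| <= b * eta.
  apply: le_trans (fluctuation_sup hK KC (h0 m) (hpdf m) (pb m) (N0 m) (h1 m) z) _.
  by apply: ler_pM; [exact: addr_ge0|exact: (e0 m)|exact: b4|exact: he].
have r_int m : (\int[(mu \x mu)%E]_z `|r m z|%:E <= (b * H * eta)%:E)%E.
  have FI := fluctuation_int hK KC (h0 m) (hpdf m) (pb m) (N0 m).
  apply: (le_trans FI).
  rewrite lee_fin -!mulrA; apply: ler_pM; [exact: addr_ge0| |exact: b5|exact: hehe].
  by apply: mulr_ge0; [exact: ltW|exact: (e0 m)].
have r_diag m : l1sup mu (fun x => r m (x, x) - e N h m * kappa * p m x)
    (b * H * eta).
  have FD := fluctuation_diag hK KC (h0 m) (hpdf m) (pb m) (N0 m)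
    (@derive1n_is_derive _ _ _ hsmooth m 0 isT)
    (@continuous_derive1n _ _ _ hsmooth m 1 isT) (hb m 1%N isT).
  apply: (le_l1sup _ FD).
  rewrite -[leLHS]mulrA -[leRHS]mulrA; apply: ler_pM;
    [exact: addr_ge0| |exact: b6|exact: hehe].
  by apply: mulr_ge0; [exact: ltW|exact: (e0 m)].
have SM := second_moment_expansion M0 b1 kb kapb pb' p2b' pi_c piE H0 H1 eta0 eta1
  hH' he' fb f_bias mr r_sup r_int r_diag.
have D1 : exists a, l1sup mu (first_order p p2 k h) a.
  by eexists; exact: (l1sup_first_order b1 kb pb' p2b' H0 hH').
have V1 : exists a, l1sup mu (first_variance p (e N h)) a.
  by eexists; exact: (l1sup_first_variance b1 pb' eta1 he').
have [a1 {}D1] := D1; have [a2 {}V1] := V1.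
rewrite MI (AMISE_barE D1 V1 pi_c).
set W := _ - _ + _ in SM *; set Z := _ + kappa * _ in SM *.
exists ((lam ^+ 2)^-1 * (W - Z)); first by congr EFin; ring.
have l0 : 0 <= (lam ^+ 2)^-1 by rewrite invr_ge0 exprn_ge0// ltW.
by rewrite normrM (ger0_norm l0) -[leRHS]mulrA; exact: ler_wpM2l.
Qed.

End UniformError.

(** * Norms on a finite-dimensional space *)

Section FiniteDimensionalNorms.
Context (R : realType) (M : nat) (M0 : (0 < M)%N) (nrm : 'rV[R]_M -> R)
  (hnrm : is_norm nrm).

Let nrm0 : nrm 0 = 0.
Proof. by have := norm_homogeneous hnrm 0 0; rewrite scale0r normr0 mul0r. Qed.

Let nrmN v : nrm (- v) = nrm v.
Proof.
have := norm_homogeneous hnrm (-1) v.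
by rewrite scaleN1r normrN normr1 mul1r.
Qed.

Lemma is_norm_ge0 v : 0 <= nrm v.
Proof.
have := norm_triangle hnrm v (- v); rewrite subrr nrm0 nrmN.
by rewrite -mulr2n pmulrn_lge0.
Qed.

Let nrm_sum (I : Type) (s : seq I) (F : I -> 'rV[R]_M) :
  nrm (\sum_(i <- s) F i) <= \sum_(i <- s) nrm (F i).
Proof.
elim: s => [|i s IH]; first by rewrite !big_nil nrm0.
rewrite !big_cons; apply: le_trans (norm_triangle hnrm _ _) _.
by rewrite lerD2l.
Qed.

Lemma is_norm_le_l1 : exists2 c : R, 0 < c & forall v : 'rV[R]_M, nrm v <= c * \sum_i `|v 0 i|.
Proof.
pose c := 1 + \sum_i nrm (delta_mx 0 i); exists c.
  by rewrite /c ltr_pwDl// sumr_ge0// => i _; exact: is_norm_ge0.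
move=> v; rewrite {1}(row_sum_delta v) mulr_sumr.
apply: le_trans (nrm_sum _ _) _; apply: ler_sum => i _.
rewrite (norm_homogeneous hnrm) mulrC ler_wpM2r//.
rewrite /c (bigD1 i)//= addrCA lerDl addr_ge0// sumr_ge0// => j _.
exact: is_norm_ge0.
Qed.

(** The norm is continuous, by the converse inequality, and does not vanish on the
    unit sphere of the maximum norm, which is compact: it has a positive minimum
    there, and homogeneity extends the bound to all vectors. *)
Lemma l1_le_is_norm : exists2 c : R, 0 < c & forall v : 'rV[R]_M, \sum_i `|v 0 i| <= c * nrm v.
Proof.
have [c c0 nc] := is_norm_le_l1.
have coord (v : 'rV[R]_M) i : `|v 0 i| <= `|v|.
  rewrite [leRHS]/Num.norm/= mx_normrE; apply/bigmax_geP; right.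
  by exists (ord0, i).
have sum_le (v : 'rV[R]_M) : \sum_i `|v 0 i| <= M%:R * `|v|.
  apply: (@le_trans _ _ (\sum_(i < M) `|v|)); first by apply: ler_sum.
  by rewrite sumr_const card_ord mulr_natl.
have nle v : nrm v <= c * M%:R * `|v|.
  by apply: le_trans (nc v) _; rewrite -mulrA ler_wpM2l// ltW.
have ndiff u v : `|nrm u - nrm v| <= nrm (u - v).
  have t1 : nrm u <= nrm (u - v) + nrm v.
    by rewrite -{1}(subrK v u); exact: norm_triangle.
  have t2 : nrm v <= nrm (u - v) + nrm u.
    by rewrite -[nrm (u - v)]nrmN opprB -{1}(subrK u v); exact: norm_triangle.
  by rewrite ler_norml; apply/andP; split; [rewrite lerNl opprB lerBlDr
    | rewrite lerBlDr].
have cnrm : continuous nrm.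
  move=> v; apply/(@cvgrPdist_le _ _ _ (nbhs v) (nbhs_filter v)) => eps eps0.
  have k0 : 0 < c * M%:R by rewrite mulr_gt0// ltr0n.
  have r0 : 0 < eps / (c * M%:R) by exact: divr_gt0.
  apply: (@filterS _ (nbhs v) (nbhs_filter v) (ball v (eps / (c * M%:R)))).
    move=> u; rewrite mx_norm_ball /ball_/= => uv.
    apply: le_trans (ndiff v u) _; apply: le_trans (nle _) _.
    by rewrite mulrC -ler_pdivlMr// ltW.
  exact: nbhsx_ballx.
pose A := [set v : 'rV[R]_M | `|v| = 1].
have Abnd : bounded_set A.
  by exists 1; split => // x x1 v /= ->; exact: ltW.
have Acl : closed A.
  apply: (@closed_comp _ _ (fun v : 'rV[R]_M => `|v|) [set 1]).
    by move=> v _; exact: norm_continuous.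
  exact: closed_eq.
have cA := bounded_closed_compact Abnd Acl.
have A0 : A !=set0.
  exists (const_mx 1); rewrite /A/= [LHS]/Num.norm/= mx_normrE.
  apply/eqP; rewrite eq_le; apply/andP; split.
    by apply: bigmax_le => // i _; rewrite mxE normr1.
  apply/bigmax_geP; right; exists (ord0, Ordinal M0) => //=.
  by rewrite mxE normr1.
have [v0 Av0 minv0] := EVT_min_rV A0 cA (continuous_subspaceT cnrm).
rewrite inE/= in Av0.
have n0 : 0 < nrm v0.
  rewrite lt_neqAle is_norm_ge0 andbT eq_sym.
  apply/eqP => /(norm_definite hnrm) v00.
  by move: Av0; rewrite /A/= v00 normr0 => /eqP; rewrite eq_sym oner_eq0.
exists (M%:R / nrm v0); first by rewrite divr_gt0// ltr0n.
move=> v; apply: le_trans (sum_le v) _; rewrite -mulrA ler_wpM2l//.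
rewrite ler_pdivlMl//.
have [->|vn0] := eqVneq v 0; first by rewrite normr0 mulr0 nrm0.
have nv : 0 < `|v| by rewrite normr_gt0.
have Av : `|v|^-1 *: v \in A.
  by rewrite inE /A/= normrZ ger0_norm ?invr_ge0// mulVf// gt_eqF.
have := minv0 _ Av; rewrite (norm_homogeneous hnrm) ger0_norm ?invr_ge0//.
by rewrite ler_pdivlMl// mulrC.
Qed.

End FiniteDimensionalNorms.

(** * The scaling regime *)

Lemma cvg0_sum (R : realType) (I : Type) (s : seq I) (F : nat -> I -> R) :
  (forall i, F n i @[n --> \oo] --> (0 : R)) ->
  \sum_(i <- s) F n i @[n --> \oo] --> (0 : R).
Proof.
move=> F0; elim: s => [|i s IH].
  rewrite (_ : (fun n => _) = cst 0); first exact: cvg_cst.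
  by apply/funext => n; rewrite big_nil.
rewrite (_ : (fun n => _) = (fun n => F n i + \sum_(j <- s) F n j)); last first.
  by apply/funext => n; rewrite big_cons.
by have := cvgD (F0 i) IH; rewrite (addr0 (0 : R)); exact.
Qed.

Section ScalingRegime.
Context (R : realType) (M : nat) (N : nat -> 'I_M -> nat) (h : nat -> 'I_M -> R).
Hypothesis hscaling : scaling N h.

Lemma scaling_gt0 n i : (0 < n)%N -> 0 < h n i /\ (0 < N n i)%N.
Proof.
move=> n0; have [h0 [D1 [D2 [/andP[D10 _] HD]]] _ _] := hscaling.
split; first exact: h0.
have /andP[+ _] := HD n i n0; rewrite lt0n => H.
apply/eqP => N0; move: H; rewrite N0 mul0r leNgt D10.
by [].
Qed.

Lemma sample_size_cvg i : (N n i)%:R @[n --> \oo] --> (+oo : set_system R).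
Proof.
have [_ [D1 [D2 [/andP[D10 _] HD]]] _ _] := hscaling.
apply/cvgryPge => A; near=> n.
have n0 : (0 < n)%N by near: n; exact: nbhs_infty_gt.
have /andP[+ _] := HD n i n0; rewrite ler_pdivlMr ?ltr0n// => H.
apply: le_trans H; rewrite -ler_pdivrMl// mulrC.
near: n; exact: nbhs_infty_ger.
Unshelve. all: by end_near. Qed.

Lemma bandwidth_cvg i : h n i @[n --> \oo] --> 0.
Proof.
have [_ _ [A1 [A2 [al [A10 A20 /andP[al0 _] HA]]]] _] := hscaling.
apply/cvgr0Pnorm_le => eps eps0; near=> n.
have n0 : (0 < n)%N by near: n; exact: nbhs_infty_gt.
have [h0 N0] := scaling_gt0 i n0.
rewrite gtr0_norm//; have /andP[_ H] := HA n i n0.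
apply: le_trans H _; rewrite powRN -ler_pdivlMl//.
rewrite -[leRHS]invrK lef_pV2 ?posrE ?powR_gt0 ?ltr0n ?invr_gt0 ?mulr_gt0 ?invr_gt0//.
set B := (A2^-1 * eps)^-1.
have B0 : 0 <= B by rewrite invr_ge0 mulr_ge0 ?invr_ge0 ?ltW.
have HB : B `^ (al^-1) <= (N n i)%:R.
  near: n; have /cvgryPge := sample_size_cvg i; exact.
have -> : B = (B `^ (al^-1)) `^ al.
  by rewrite -powRrM mulVf ?powRr1// gt_eqF.
by apply: ge0_ler_powR; rewrite ?nnegrE ?powR_ge0// ltW.
Unshelve. all: by end_near. Qed.

(** The sample sizes are all comparable to n, and each bandwidth is comparable to
    the same power of its sample size. *)
Lemma comparable_sizes : exists2 c : R, 0 < c &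
  forall n i j, (0 < n)%N -> (N n i)%:R <= c * (N n j)%:R /\ h n i <= c * h n j.
Proof.
have [_ [D1 [D2 [/andP[D10 D12] HD]]] [A1 [A2 [al [A10 A20 /andP[al0 _] HA]]]] _] :=
  hscaling.
have D20 : 0 < D2 by exact: lt_trans D12.
pose rho := D2 / D1; have rho0 : 0 < rho by exact: divr_gt0.
pose sig := A2 / A1 * rho `^ al.
have sig0 : 0 < sig by rewrite mulr_gt0 ?divr_gt0 ?powR_gt0.
have HN n i j : (0 < n)%N -> (N n i)%:R <= rho * (N n j)%:R.
  move=> n0; have nr : 0 < n%:R :> R by rewrite ltr0n.
  have /andP[_ +] := HD n i n0; have /andP[+ _] := HD n j n0.
  rewrite ler_pdivlMr// ler_pdivrMr// => Hj Hi.
  apply: le_trans Hi _; rewrite /rho -mulrA ler_wpM2l ?(ltW D20)//.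
  by rewrite ler_pdivlMl.
exists (rho + sig); first exact: addr_gt0.
move=> n i j n0; have [hj0 Nj0] := scaling_gt0 j n0.
have [hi0 Ni0] := scaling_gt0 i n0.
split.
  apply: le_trans (HN n i j n0) _; rewrite ler_wpM2r//.
  by rewrite lerDl ltW.
apply: (@le_trans _ _ (sig * h n j)); last first.
  by rewrite ler_wpM2r ?(ltW hj0)// lerDr ltW.
have /andP[_ Hi] := HA n i n0; have /andP[Hj _] := HA n j n0.
apply: le_trans Hi _.
apply: (@le_trans _ _ (sig * (A1 * (N n j)%:R `^ (- al)))); last first.
  by rewrite ler_wpM2l// ltW.
have -> : sig * (A1 * (N n j)%:R `^ (- al)) =
    A2 * (rho `^ al * (N n j)%:R `^ (- al)).
  by rewrite /sig; field; rewrite gt_eqF.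
rewrite ler_wpM2l ?(ltW A20)// !powRN.
have pi0 : 0 < (N n i)%:R `^ al :> R by rewrite powR_gt0// ltr0n.
have pj0 : 0 < (N n j)%:R `^ al :> R by rewrite powR_gt0// ltr0n.
rewrite ler_pdivlMr// mulrC ler_pdivrMr//.
rewrite -powRM ?(ltW rho0)//.
apply: ge0_ler_powR.
- exact: ltW.
- by rewrite nnegrE.
- by rewrite nnegrE mulr_ge0// ltW.
- exact: (HN n j i n0).
Qed.

End ScalingRegime.

Section NormScaling.
Context (R : realType) (M : nat) (M0 : (0 < M)%N)
    (nrm : 'rV[R]_M -> R) (hnrm : is_norm nrm)
    (N : nat -> 'I_M -> nat) (h : nat -> 'I_M -> R) (hscaling : scaling N h).
Let normh n := nrm (\row_m h n m).
Let normN n := nrm (\row_m (N n m)%:R).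
Let e n m : R := ((N n m)%:R * h n m)^-1.

Lemma inv_effective_size_cvg m : e n m @[n --> \oo] --> 0.
Proof.
have [_ _ _ /(_ m) H] := hscaling.
have : (fun n => (h n m * (N n m)%:R)^-1) @ \oo --> (0 : R).
  apply/gtr0_cvgV0 => //; near=> n.
  have n0 : (0 < n)%N by near: n; exact: nbhs_infty_gt.
  by have [h0 N0] := scaling_gt0 hscaling m n0; rewrite mulr_gt0// ltr0n.
by apply: cvg_trans; apply: near_eq_cvg; near=> n; rewrite /e /= mulrC.
Unshelve. all: by end_near. Qed.

(** Equivalence of norms alone compares the sums of the components, which gives
    the first and the last bounds; comparing 1 / (N_m h_m) with the product of
    the norms requires components of the same order. *)
Lemma norm_scaling : exists2 c : R, 0 < c & forall n, (0 < n)%N ->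
  [/\ \sum_m h n m <= c * normh n,
      forall m, e n m <= c * (normN n * normh n)^-1,
      0 < normN n, 0 < normh n &
      forall m, (normN n * normh n)^-1 <= c * e n m].
Proof.
have [c1 c10 H1] := is_norm_le_l1 hnrm.
have [c2 c20 H2] := l1_le_is_norm M0 hnrm.
have [c3 c30 H3] := comparable_sizes hscaling.
pose c4 := c1 * (M%:R * c3).
have Mr0 : 0 < M%:R :> R by rewrite ltr0n.
have c40 : 0 < c4 by rewrite !mulr_gt0.
exists (c2 + c4 ^+ 2 + c2 ^+ 2).
  by rewrite !addr_gt0// exprn_gt0.
move=> n n0.
have hp m : 0 < h n m by have [] := scaling_gt0 hscaling m n0.
have Np m : 0 < (N n m)%:R :> R.
  by rewrite ltr0n; have [] := scaling_gt0 hscaling m n0.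
have sh : \sum_i `|(\row_m h n m) 0 i| = \sum_m h n m.
  by apply: eq_bigr => i _; rewrite mxE gtr0_norm.
have sN : \sum_i `|(\row_m (N n m)%:R : 'rV[R]_M) 0 i| = \sum_m (N n m)%:R.
  by apply: eq_bigr => i _; rewrite mxE gtr0_norm.
have hs m : h n m <= \sum_i h n i.
  by rewrite (bigD1 m)//= lerDl sumr_ge0// => i _; exact: ltW.
have Ns m : (N n m)%:R <= \sum_i (N n i)%:R :> R.
  by rewrite (bigD1 m)//= lerDl sumr_ge0.
have h2 : \sum_m h n m <= c2 * normh n by rewrite -sh; exact: H2.
have N2 : \sum_m (N n m)%:R <= c2 * normN n by rewrite -sN; exact: H2.
have h4 m : normh n <= c4 * h n m.
  apply: le_trans (H1 _) _; rewrite sh /c4 -!mulrA ler_wpM2l ?(ltW c10)//.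
  rewrite mulrA; apply: (@le_trans _ _ (\sum_(i < M) c3 * h n m)).
    by apply: ler_sum => i _; have [] := H3 n i m n0.
  by rewrite sumr_const card_ord mulr_natl -mulrnAl.
have N4 m : normN n <= c4 * (N n m)%:R.
  apply: le_trans (H1 _) _; rewrite sN /c4 -!mulrA ler_wpM2l ?(ltW c10)//.
  rewrite mulrA; apply: (@le_trans _ _ (\sum_(i < M) c3 * (N n m)%:R)).
    by apply: ler_sum => i _; have [] := H3 n i m n0.
  by rewrite sumr_const card_ord mulr_natl -mulrnAl.
have m0 := Ordinal M0.
have nh0 : 0 < normh n.
  by rewrite -(pmulr_rgt0 _ c20); apply: lt_le_trans h2; exact: lt_le_trans (hs m0).
have nN0 : 0 < normN n.
  by rewrite -(pmulr_rgt0 _ c20); apply: lt_le_trans N2; exact: lt_le_trans (Ns m0).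
have q0 : 0 < (normN n * normh n)^-1 by rewrite invr_gt0 mulr_gt0.
have e0 m : 0 < e n m by rewrite invr_gt0 mulr_gt0.
split=> //.
- apply: le_trans h2 _; rewrite ler_wpM2r ?(ltW nh0)//.
  by rewrite -addrA lerDl addr_ge0// exprn_ge0// ltW.
- move=> m; apply: (@le_trans _ _ (c4 ^+ 2 * (normN n * normh n)^-1)); last first.
    rewrite ler_wpM2r ?(ltW q0)// addrAC lerDr addr_ge0// ?exprn_ge0// ltW//.
  rewrite ler_pdivlMr ?mulr_gt0// mulrC ler_pdivrMr ?mulr_gt0//.
  have -> : c4 ^+ 2 * ((N n m)%:R * h n m) = (c4 * (N n m)%:R) * (c4 * h n m).
    by ring.
  by rewrite ler_pM ?(ltW nN0) ?(ltW nh0).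
- move=> m; apply: (@le_trans _ _ (c2 ^+ 2 * e n m)); last first.
    rewrite ler_wpM2r ?(ltW (e0 m))// lerDr addr_ge0// ?exprn_ge0// ltW//.
  rewrite /e ler_pdivlMr ?mulr_gt0// mulrC ler_pdivrMr ?mulr_gt0//.
  have -> : c2 ^+ 2 * (normN n * normh n) = (c2 * normN n) * (c2 * normh n).
    by ring.
  by rewrite ler_pM ?(ltW (Np m)) ?(ltW (hp m))// ?(le_trans (Ns m))// (le_trans (hs m)).
Qed.

Lemma inv_norm_product_cvg : (normN n * normh n)^-1 @[n --> \oo] --> 0.
Proof.
have [c c0 Hc] := norm_scaling; pose m0 := Ordinal M0.
have L : c * e n m0 @[n --> \oo] --> 0.
  have := cvgM (cvg_cst c) (inv_effective_size_cvg m0).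
  by rewrite mulr0; exact.
apply: (squeeze_cvgr _ (cvg_cst 0) L).
near=> n; have n0 : (0 < n)%N by near: n; exact: nbhs_infty_gt.
have [_ _ nN nh H] := Hc n n0.
by rewrite H andbT invr_ge0 mulr_ge0// ltW.
Unshelve. all: by end_near. Qed.

Let H n := \sum_m h n m.
Let eta n := \sum_m e n m.

(** Every term of the bound is H or eta, which tend to 0, times H^4 or eta, which
    are dominated by the two terms of the scale. *)
Lemma littleo_error (E : nat -> R) (A : R) :
  (forall n, (0 < n)%N -> H n <= 1 -> eta n <= 1 ->
     `|E n| <= A * (H n ^+ 5 + H n * eta n + eta n ^+ 2)) ->
  E =o_\oo (fun n => normh n ^+ 4 + (normN n * normh n)^-1).
Proof.
move=> HE; have [c c0 Hc] := norm_scaling.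
have Hcvg : H n @[n --> \oo] --> 0.
  by apply: cvg0_sum => m; exact: (bandwidth_cvg hscaling).
have ecvg : eta n @[n --> \oo] --> 0.
  by apply: cvg0_sum => m; exact: inv_effective_size_cvg.
apply/eqoP => eps eps0.
pose B := `|A| * (c ^+ 4 + M%:R * c) + 1.
have c0' : 0 <= c by exact: ltW.
have cM0 : 0 <= c ^+ 4 + M%:R * c by rewrite addr_ge0 ?exprn_ge0 ?mulr_ge0.
have B0 : 0 < B by rewrite ltr_wpDl// mulr_ge0.
have d0 : 0 < eps / (2 * B) by rewrite divr_gt0// mulr_gt0.
near=> n; have n0 : (0 < n)%N by near: n; exact: nbhs_infty_gt.
have [Hh He nN nh _] := Hc n n0.
have hp m : 0 < h n m by have [] := scaling_gt0 hscaling m n0.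
have ep m : 0 <= e n m by rewrite invr_ge0 mulr_ge0// ltW.
have H0 : 0 <= H n by apply: sumr_ge0 => m _; exact: ltW.
have eta0 : 0 <= eta n by apply: sumr_ge0.
have H1 : H n <= 1.
  rewrite -(ger0_norm H0); near: n.
  by move/cvgr0Pnorm_le : Hcvg; apply.
have e1 : eta n <= 1.
  rewrite -(ger0_norm eta0); near: n.
  by move/cvgr0Pnorm_le : ecvg; apply.
have Hs : H n <= eps / (2 * B).
  rewrite -(ger0_norm H0); near: n.
  by move/cvgr0Pnorm_le : Hcvg; apply.
have es : eta n <= eps / (2 * B).
  rewrite -(ger0_norm eta0); near: n.
  by move/cvgr0Pnorm_le : ecvg; apply.
set q := (normN n * normh n)^-1; have q0 : 0 <= q.
  by rewrite invr_ge0 mulr_ge0// ltW.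
have a0 : 0 <= normh n ^+ 4 by rewrite exprn_ge0// ltW.
have eq1 : eta n <= M%:R * c * q.
  apply: (@le_trans _ _ (\sum_(m < M) c * q)); first by apply: ler_sum.
  by rewrite sumr_const card_ord mulr_natl -mulrnAl.
have H4 : H n ^+ 4 <= c ^+ 4 * normh n ^+ 4.
  by rewrite -exprMn lerXn2r// nnegrE// mulr_ge0// ltW.
apply: le_trans (HE n n0 H1 e1) _.
rewrite [leRHS]mulrC (ger0_norm (addr_ge0 a0 q0)) [leRHS]mulrC.
apply: (@le_trans _ _ (`|A| * ((H n + eta n) *
    (c ^+ 4 * normh n ^+ 4 + M%:R * c * q)))).
  apply: (@le_trans _ _ (`|A| * (H n ^+ 5 + H n * eta n + eta n ^+ 2))).
    rewrite ler_wpM2r ?ler_norm// !addr_ge0 ?exprn_ge0// mulr_ge0//.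
  rewrite ler_wpM2l//.
  have s1 := ler_wpM2l H0 H4; have s2 := ler_wpM2l H0 eq1.
  have s3 := ler_wpM2l eta0 eq1.
  have s4 : 0 <= eta n * (c ^+ 4 * normh n ^+ 4).
    by apply: mulr_ge0 => //; apply: mulr_ge0 => //; exact: exprn_ge0.
  have -> : H n ^+ 5 + H n * eta n + eta n ^+ 2 =
    H n * H n ^+ 4 + H n * eta n + eta n * eta n by ring.
  rewrite [leRHS]mulrDl !mulrDr; lra.
apply: (@le_trans _ _ (`|A| * ((eps / B) *
    ((c ^+ 4 + M%:R * c) * (normh n ^+ 4 + q))))).
  rewrite ler_wpM2l//; apply: ler_pM.
  - exact: addr_ge0.
  - apply: addr_ge0; first by apply: mulr_ge0 => //; exact: exprn_ge0.
    by apply: mulr_ge0 => //; exact: mulr_ge0.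
  - have -> : eps / B = eps / (2 * B) + eps / (2 * B).
      by field; rewrite gt_eqF.
    exact: lerD.
  - rewrite mulrDl !mulrDr lerD//.
      by rewrite lerDl; apply: mulr_ge0 => //; exact: exprn_ge0.
    by rewrite lerDr; apply: mulr_ge0 => //; exact: mulr_ge0.
have -> : `|A| * (eps / B * ((c ^+ 4 + M%:R * c) * (normh n ^+ 4 + q))) =
    eps * (normh n ^+ 4 + q) * ((`|A| * (c ^+ 4 + M%:R * c)) / B).
  by field; rewrite gt_eqF.
rewrite ler_piMr ?mulr_ge0 ?addr_ge0 ?(ltW eps0)//.
by rewrite ler_pdivrMr// mul1r /B lerDl.
Unshelve. all: by end_near. Qed.

End NormScaling.

(** * The asymptotic expansion *)

Theorem theorem4p6 (R : realType) (M : nat) (hM : (1 <= M)%N)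
    (p : 'I_M -> R -> R) (hpdf : forall m, is_pdf (p m))
    (hsmooth : forall m, smooth_density (p m))
    (hlambda : 0 < prod_mass p)
    (K : R -> R) (hK : kde_kernel K)
    (nrm : 'rV[R]_M -> R) (hnrm : is_norm nrm)
    (N : nat -> 'I_M -> nat) (h : nat -> 'I_M -> R) (hscaling : scaling N h)
    (d : measure_display) (T : measurableType d) (P : probability T R)
    (X : nat -> 'I_M -> nat -> {RV P >-> R})
    (hX : forall n, (0 < n)%N -> sample p (N n) (X n)) :
  let normh n := nrm (\row_m h n m) in
  let normN n := nrm (\row_m (N n m)%:R) in
  [/\ forall m, h n m @[n --> \oo] --> 0,
      forall m, (N n m)%:R @[n --> \oo] --> (+oo : set_system R),
      (normN n * normh n)^-1 @[n --> \oo] --> 0 &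
      exists E : nat -> R,
        (forall n, (0 < n)%N ->
          MISE_bar p K (N n) (h n) (X n)
            = (AMISE_bar p K (N n) (h n) + E n)%:E) /\
        E =o_\oo (fun n => normh n ^+ 4 + (normN n * normh n)^-1)].
Proof.
move=> normh normN.
have p0 n m (n0 : (0 < n)%N) := scaling_gt0 hscaling m n0.
split.
- by move=> m; exact: bandwidth_cvg hscaling _.
- by move=> m; exact: sample_size_cvg hscaling _.
- exact: inv_norm_product_cvg.
- exists (fun n => fine (MISE_bar p K (N n) (h n) (X n)) - AMISE_bar p K (N n) (h n)).
  split=> [n n0|].
    rewrite addrC subrK fineK//.
    apply: MISE_bar_fin_num => //; [|..|exact: hX] => m; by case: (p0 n m n0).
  have [A HA] := MISE_bar_expansion hM hpdf hsmooth hlambda hK P.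
  apply: (littleo_error hM hnrm hscaling (A := A)) => n n0 H1 e1.
  have h0 m : 0 < h n m by case: (p0 n m n0).
  have N0 m : (0 < N n m)%N by case: (p0 n m n0).
  have [| |E -> HE] := HA (N n) (h n) (X n) _ _ N0 h0 (hX n n0) _ H1 _ e1.
  - by move=> m; rewrite (bigD1 m)//= lerDl sumr_ge0// => i _; exact: ltW.
  - move=> m; rewrite [leRHS](bigD1 m)//= lerDl sumr_ge0// => i _.
    by rewrite invr_ge0 mulr_ge0// ltW.
  by rewrite /= addrC addKr.
Qed.
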